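(* Let $a$, $b$, $c$ be non-zero, square-free, pairwise relatively prime integers (of any signs). Let $N$ be a non-zero rational number and write $N=nm^2$ where $n$ is a square-free integer and $m$ is a rational number. Then $N$ is represented by $ax^2+by^2+cz^2$ over the rational numbers if and only if all of the following conditions hold. (1) If $a$, $b$, $c$ are all positive then $N$ is positive, and if $a,b,c$ are all negative then $N$ is negative. (2) If $a$, $b$, $c$ are odd and $a\equiv b\equiv c\pmod 4$, then $n\not\equiv -abc\pmod 8$. (3) If one of $a,b,c$ is even and, naming the coefficients so that $a$ is the even one, $b+c\equiv a\pmod 8$ or $b+c\equiv 2a\pmod 8$, then $n\not\equiv -abc\pmod{16}$. (4) For every odd prime $p$ with $p\mid n$ and $p\mid a$, either $\left(\frac{-bc}{p}\right)=1$ or $\left(\frac{na/p^2}{p}\right)=1$; for every odd prime $p$ with $p\mid n$ and $p\mid b$, either $\left(\frac{-ac}{p}\right)=1$ or $\left(\frac{nb/p^2}{p}\right)=1$; and for every odd prime $p$ with $p\mid n$ and $p\mid c$, either $\left(\frac{-ab}{p}\right)=1$ or $\left(\frac{nc/p^2}{p}\right)=1$.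
   Context: $\left(\frac{\cdot}{p}\right)$ denotes the Legendre symbol. $N$ is represented by $ax^2+by^2+cz^2$ over the rational numbers if there exist $x,y,z\in\mathbb{Q}$ with $ax^2+by^2+cz^2=N$. *)

(* Defs.v *)
From mathcomp Require Import all_boot all_order all_algebra.

Set Implicit Arguments.
Unset Strict Implicit.
Unset Printing Implicit Defensive.

Import Order.TTheory GRing.Theory Num.Theory.
Local Open Scope ring_scope.

(* 1 and -1 are square-free; 0 is not, since every d ^+ 2 divides 0. *)
Definition squarefree (n : int) : Prop :=
  forall d : int, (d ^+ 2 %| n)%Z -> `|d| = 1.

(* This is the Legendre symbol only when p is an odd prime. *)
Definition legendre (a : int) (p : nat) : int :=
  if (p %| a)%Z then 0
  else if [exists x : 'I_p, (x%:Z ^+ 2 == a %[mod p])%Z] then 1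
  else -1.

Definition represented (a b c : int) (N : rat) : Prop :=
  exists x y z : rat,
    a%:~R * x ^+ 2 + b%:~R * y ^+ 2 + c%:~R * z ^+ 2 = N.

(* Main.v *)
(* Split the equation a x^2 + b y^2 + c z^2 = n w^2 as
     a x^2 + b y^2 = t = n w^2 - c z^2.
   For a given t, each half is a ternary equation, hence solvable over the
   rationals as soon as one Hilbert symbol is trivial at infinity and at every
   odd prime (Serre's descent). So everything comes down to a t whose symbols
   are trivial at all places. At a single place, the existence of a suitable
   local t is a finite question about square classes, and its answer is
   conditions (1)-(4). Local choices of t at the finitely many bad places are
   matched by a global t up to one extra prime q, by Dirichlet's theorem for
   quadratic characters, and the product formula (quadratic reciprocity) makes
   the symbols at q trivial. Dirichlet's theorem is obtained from finite sums
   only: Mertens' argument, with Monsky's proof that L(1, chi) does not vanish. *)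

Require Import Defs.
From mathcomp Require Import all_boot all_order all_algebra.
From mathcomp Require Import fingroup cyclic finfield closed_field.
From mathcomp Require Import zify ring lra.
From mathcomp Require Import reals Rstruct.
From mathcomp Require exp.

Set Implicit Arguments.
Unset Strict Implicit.
Unset Printing Implicit Defensive.

Import Order.TTheory GRing.Theory Num.Theory.
Local Open Scope ring_scope.

(** * Quadratic residues and reciprocity *)

(** A symbol sees an integer only through its square class, that is, through the parity of its
    valuation and the characters of its unit part. Local solvability is therefore a statement about
    booleans, and no p-adic number appears. The prime 2 can be left out of the ternary criterion
    because the product formula makes the symbol at 2 follow from the others; for the same reason
    necessity at 2 needs no 2-adic argument. The condition at 2 does matter when t is built: both
    halves share t, hence also q, and each half has its own product formula, in which q is the only
    place left open. Since only square classes of q are prescribed, real characters suffice; these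
    are the characters for which the non-vanishing of L(1, chi) is the delicate point of Dirichlet's
    theorem. The symbols demand that t be nonzero, and the passage back to N demands that w be
    nonzero; the exceptional cases lead to isotropic forms, which represent everything. *)

Section EulerCriterion.
Variables (F : finFieldType) (oddF : odd #|F|).
Let h := #|F|.-1./2.

Lemma card_pred_half : h.*2 = #|F|.-1.
Proof.
rewrite /h -[RHS]odd_double_half; case: #|F| oddF => //= n /negbTE -> //.
Qed.

Lemma half_card_gt0 : (0 < h)%N.
Proof.
rewrite -double_gt0 card_pred_half; have := card_finRing_gt1 F.
by case: #|F| => [|[]].
Qed.

Lemma euler_cases (x : F) : x != 0 -> x ^+ h = 1 \/ x ^+ h = -1.
Proof.
move=> x0; have : (x ^+ h) ^+ 2 = 1.
  rewrite -exprM muln2 card_pred_half; apply: (mulfI x0).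
  by rewrite -exprS prednK ?mulr1 ?expf_card // (ltn_trans _ (card_finRing_gt1 F)).
by move/eqP; rewrite sqrf_eq1 => /orP[] /eqP; [left | right].
Qed.

Lemma unit_generator : exists g : F, [/\ g != 0, g ^+ h != 1 &
  forall x, x != 0 -> exists k, x = g ^+ k].
Proof.
have /cyclicP[g Hg] := field_unit_group_cyclic [set: {unit F}]%G.
have og : #[g]%g = #|F|.-1 by rewrite -card_finField_unit Hg.
have vX k : val (g ^+ k)%g = (val g) ^+ k by rewrite FinRing.val_unitX.
exists (val g); split.
- by have := valP g; rewrite unitfE.
- rewrite -vX; apply/negP => /eqP gh.
  have : (g ^+ h)%g = 1%g by apply: val_inj; rewrite gh.
  move/eqP; rewrite -order_dvdn og -card_pred_half => /dvdn_leq.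
  by rewrite half_card_gt0 leqNgt -addnn -[ltnLHS]addn0 ltn_add2l half_card_gt0 => /(_ isT).
- move=> x x0; have ux : x \is a GRing.unit by rewrite unitfE.
  have : FinRing.unit F ux \in <[g]>%g by rewrite -Hg inE.
  by case/cycleP => k Hk; exists k; rewrite -vX -Hk.
Qed.

Lemma euler_square (x : F) : x != 0 -> x ^+ h = 1 <-> exists y, x = y ^+ 2.
Proof.
move=> x0; split=> [xh|[y xy]]; last first.
  have y0 : y != 0 by apply: contraNneq x0 => y0; rewrite xy y0 expr0n.
  by rewrite xy -exprM mulnC exprM; case: (euler_cases y0) => ->; rewrite ?sqrrN expr1n.
have [g [g0 gh gP]] := unit_generator.
have [k xk] := gP _ x0; exists (g ^+ k./2).
move: xh; rewrite xk -exprM mulnC exprM.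
case: (euler_cases g0) => E; rewrite E; first by rewrite E eqxx in gh.
rewrite -signr_odd -{2}[k]odd_double_half; case: odd => [|_].
  by rewrite expr1 => N1; rewrite E N1 eqxx in gh.
by rewrite add0n -muln2 exprM.
Qed.

End EulerCriterion.

(** Defined through Euler's criterion rather than through squares, which makes it multiplicative at
    sight; [qnr_square] recovers the squares. *)
Definition qnr (p : nat) (x : int) : bool :=
  (x%:~R : 'F_p) ^+ (p.-1./2) == -1.

Section Residues.
Variables (p : nat) (p_pr : prime p) (p_odd : odd p).

Lemma Fp_eq0 (x : int) : (x%:~R == 0 :> 'F_p) = (p %| x)%Z.
Proof. by rewrite (dvdz_pcharf (pchar_Fp p_pr)). Qed.

Lemma odd_card_Fp : odd #|'F_p|. Proof. by rewrite card_Fp. Qed.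

Lemma Fp_val_intr (y : 'F_p) : (Posz (val y))%:~R = y.
Proof. by rewrite -pmulrn natr_Zp. Qed.

Lemma Fp_opp1 : (-1 == 1 :> 'F_p) = false.
Proof.
rewrite -[-1]mulN1r -subr_eq0 mulr1 -opprD oppr_eq0.
have -> : 1 + 1 = (2 : int)%:~R :> 'F_p by [].
rewrite Fp_eq0; apply/negP => /dvdn_leq -/(_ isT).
by rewrite leqNgt odd_prime_gt2.
Qed.

Lemma qnrE (x : int) : ~~ (p %| x)%Z ->
  (x%:~R : 'F_p) ^+ (p.-1./2) = (-1) ^+ qnr p x.
Proof.
rewrite -Fp_eq0 => /(euler_cases odd_card_Fp); rewrite card_Fp // /qnr.
by case=> ->; rewrite ?eqxx // eq_sym Fp_opp1.
Qed.

Lemma signFp_inj : injective (fun b : bool => (-1) ^+ b : 'F_p).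
Proof.
by case=> [] [] //= /eqP; rewrite expr1 expr0 ?Fp_opp1 // eq_sym Fp_opp1.
Qed.

Lemma ndvdzM (x y : int) : ~~ (p %| x)%Z -> ~~ (p %| y)%Z -> ~~ (p %| x * y)%Z.
Proof. by rewrite -!Fp_eq0 rmorphM mulf_eq0 negb_or => -> ->. Qed.

Lemma qnrM (x y : int) : ~~ (p %| x)%Z -> ~~ (p %| y)%Z ->
  qnr p (x * y) = qnr p x (+) qnr p y.
Proof.
move=> px py; apply: signFp_inj.
rewrite /= -qnrE ?ndvdzM // rmorphM exprMn !qnrE //.
by rewrite signr_addb.
Qed.

Lemma qnr_square (x : int) : ~~ (p %| x)%Z ->
  ~~ qnr p x <-> exists y : int, (p %| x - y ^+ 2)%Z.
Proof.
move=> px; have x0 : (x%:~R : 'F_p) != 0 by rewrite Fp_eq0.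
have := euler_square odd_card_Fp x0; rewrite card_Fp // qnrE //.
have E : ((-1) ^+ qnr p x = 1 :> 'F_p) <-> ~~ qnr p x.
  by case: qnr; split => // /eqP; rewrite expr1 Fp_opp1.
case=> H1 H2; split=> [/E/H1[y xy]|[y]].
  exists (val y : int).
  by rewrite -Fp_eq0 rmorphB rmorphXn /= xy Fp_val_intr subrr.
by rewrite -Fp_eq0 rmorphB rmorphXn /= subr_eq0 => /eqP xy; apply/E/H2; exists (y%:~R).
Qed.

Lemma eq_qnr (x y : int) : (p %| x - y)%Z -> qnr p x = qnr p y.
Proof. by rewrite -Fp_eq0 rmorphB subr_eq0 /qnr => /eqP ->. Qed.

Lemma qnr1 : qnr p 1 = false.
Proof. by rewrite /qnr expr1n eq_sym Fp_opp1. Qed.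

Lemma exists_qnr : exists x : nat, ~~ (p %| x)%N /\ qnr p x.
Proof.
have [g [g0 gh _]] := unit_generator odd_card_Fp.
exists (val g); split.
  by rewrite (dvdn_pcharf (pchar_Fp p_pr)) pmulrn Fp_val_intr.
rewrite card_Fp // in gh.
rewrite /qnr Fp_val_intr; have := euler_cases odd_card_Fp g0; rewrite card_Fp //.
by case=> /eqP //; rewrite (negbTE gh).
Qed.

Lemma legendre_qnr (x : int) : ~~ (p %| x)%Z ->
  legendre x p = 1 <-> ~~ qnr p x.
Proof.
move=> px; have [H1 H2] := qnr_square px; rewrite /legendre (negbTE px).
case: ifPn => [/existsP[y /eqP Hy]|/existsPn H]; split => //.
  by move=> _; apply: H2; exists (y%:Z); rewrite -eqz_mod_dvd eq_sym; apply/eqP.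
case/H1=> y Hy.
have p0 : (p%:Z != 0) by rewrite -lt0n prime_gt0.
have yp : (`|(y %% p)%Z| < p)%N.
  by have := ltz_mod y p0; rewrite -{1}(gez0_abs (modz_ge0 y p0)).
have /negP[] := H (Ordinal yp).
rewrite /= gez0_abs ?modz_ge0 //; move: Hy.
rewrite -!eqz_mod_dvd eq_sym => /eqP <-.
by rewrite -modzXm modz_mod modzXm.
Qed.

Lemma qnrN1 : qnr p (-1) = (p %% 4 == 3)%N.
Proof.
apply: signFp_inj => /=; rewrite -qnrE; last first.
  by rewrite dvdzE /= dvdn1; case: p p_pr => [|[]].
rewrite rmorphN1 -[LHS]signr_odd; congr (_ ^+ nat_of_bool _).
by move: p_odd; lia.
Qed.

End Residues.

(** * Gauss sums and the reciprocity laws *)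

Section GaussSum.
Variables (p : nat) (p_pr : prime p) (p_odd : odd p).
Variables (K : fieldType) (zeta : K).
Hypothesis K2 : (2%:R : K) != 0.
Hypothesis sum_zeta : \sum_(i < p) zeta ^+ i = 0.
Hypothesis zeta_p : zeta ^+ p = 1.

Definition quad_char (x : 'F_p) : K :=
  (x != 0)%:R * (-1) ^+ (x ^+ p.-1./2 == -1).
Definition add_char (x : 'F_p) : K := zeta ^+ (val x).
Definition gauss_sum : K := \sum_x quad_char x * add_char x.

Lemma quad_char0 : quad_char 0 = 0.
Proof. by rewrite /quad_char eqxx mul0r. Qed.

Lemma quad_charM (x y : 'F_p) : quad_char (x * y) = quad_char x * quad_char y.
Proof.
have [->|x0] := eqVneq x 0; first by rewrite mul0r quad_char0 mul0r.
have [->|y0] := eqVneq y 0; first by rewrite mulr0 quad_char0 mulr0.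
rewrite /quad_char mulf_eq0 negb_or x0 y0 !mul1r -signr_addb; congr (_ ^+ nat_of_bool _).
rewrite exprMn; have := euler_cases (odd_card_Fp p_pr p_odd).
rewrite card_Fp // => E; have N1 := Fp_opp1 p_pr p_odd.
by case: (E _ x0) => ->; case: (E _ y0) => ->;
  rewrite ?mulr1 ?mulrNN ?mul1r ?mulN1r ?opprK ?eqxx ?[1 == -1]eq_sym ?N1.
Qed.

Lemma quad_char_sq (x : 'F_p) : x != 0 -> quad_char x ^+ 2 = 1.
Proof. by move=> x0; rewrite /quad_char x0 mul1r sqrr_sign. Qed.

Lemma sum_quad_char : \sum_x quad_char x = 0.
Proof.
have [g [g0 gh _]] := unit_generator (odd_card_Fp p_pr p_odd).
have := euler_cases (odd_card_Fp p_pr p_odd) g0.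
case=> gE; first by rewrite gE eqxx in gh.
have Eg : quad_char g = -1.
  by move: gE; rewrite /quad_char g0 card_Fp // => ->; rewrite eqxx mul1r.
have E : \sum_x quad_char x = - \sum_x quad_char x.
  rewrite {1}(reindex_inj (mulfI g0)) /= -sumrN; apply: eq_bigr => x _.
  by rewrite quad_charM Eg mulN1r.
apply/eqP; move/eqP: E; rewrite -subr_eq0 opprK -mulr2n -mulr_natl mulf_eq0.
by rewrite (negbTE K2).
Qed.

Lemma add_charD (x y : 'F_p) : add_char (x + y) = add_char x * add_char y.
Proof.
by rewrite /add_char -exprD -[RHS](expr_mod _ zeta_p) /= {3}Fp_cast.
Qed.

Lemma add_char0 : add_char 0 = 1. Proof. by []. Qed.

Lemma sum_add_char (c : 'F_p) :
  \sum_x add_char (c * x) = if c == 0 then p%:R else 0.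
Proof.
case: eqVneq => [->|c0].
  under eq_bigr do rewrite mul0r add_char0.
  by rewrite sumr_const card_Fp.
have -> : \sum_x add_char (c * x) = \sum_x add_char x.
  by rewrite [RHS](reindex_inj (mulfI c0)).
by rewrite -[in RHS]sum_zeta -[in RHS](Fp_cast p_pr).
Qed.

(** In the double sum over x and y, substitute y = x z: the factor chi(x)^2 disappears, and
    orthogonality over x isolates z = -1. *)
Lemma gauss_sum_sq : gauss_sum ^+ 2 = quad_char (-1) * p%:R.
Proof.
have -> : gauss_sum ^+ 2 =
    \sum_(x | x != 0) \sum_z quad_char z * add_char (x * (1 + z)).
  rewrite expr2 {1}/gauss_sum (bigD1 0) //= quad_char0 mul0r add0r mulr_suml.
  apply: eq_bigr => x x0; rewrite mulr_sumr (reindex_inj (mulfI x0)) /=.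
  apply: eq_bigr => z _; rewrite mulrDr mulr1 add_charD quad_charM.
  by rewrite mulrACA [quad_char x * (_ * _)]mulrA -expr2 quad_char_sq // mul1r.
rewrite exchange_big /=.
transitivity (\sum_z quad_char z * ((if 1 + z == 0 then p%:R else 0) - 1)).
  apply: eq_bigr => z _; rewrite -mulr_sumr; congr (_ * _).
  rewrite -sum_add_char [in RHS](bigD1 0) //= mulr0 add_char0 addrAC subrr add0r.
  by apply: eq_bigr => x _; rewrite mulrC.
under eq_bigr do rewrite mulrBr mulr1.
rewrite sumrB sum_quad_char subr0 (bigD1 (-1)) //= subrr eqxx big1 ?addr0 //.
by move=> z; rewrite addrC addr_eq0 => /negbTE ->; rewrite mulr0.
Qed.

(** Frobenius acts on each term: it fixes chi(x), as q is odd, and sends zeta^x to zeta^(q x).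
    Reindexing by q x brings out chi(q). *)
Lemma gauss_sum_Frobenius q : odd q -> q \in [pchar K] -> ~~ (p %| q)%N ->
  gauss_sum ^+ q = quad_char q%:R * gauss_sum.
Proof.
move=> q_odd qK pq; rewrite -(pFrobenius_autE qK) rmorph_sum /=.
have q0 : (q%:R : 'F_p) != 0 by rewrite -(dvdn_pcharf (pchar_Fp p_pr)).
rewrite mulr_sumr [in RHS](reindex_inj (mulfI q0)) /=; apply: eq_bigr => x _.
rewrite rmorphM /= !pFrobenius_autE quad_charM.
rewrite [RHS]mulrA (mulrA (quad_char q%:R)) -expr2 quad_char_sq // mul1r.
congr (_ * _).
  have [->|x0] := eqVneq x 0; first by rewrite quad_char0 expr0n; case: q q_odd {qK pq q0}.
  by rewrite -[in LHS](odd_double_half q) q_odd add1n exprS -muln2 mulnC exprM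
    quad_char_sq // expr1n mulr1.
rewrite /add_char -exprM -[LHS](expr_mod _ zeta_p) -[RHS](expr_mod _ zeta_p); congr (_ ^+ _).
have -> : q%:R * x = (q * x)%:R by rewrite natrM natr_Zp.
rewrite mulnC -[LHS]modn_mod; congr modn.
exact/esym/val_Fp_nat.
Qed.

End GaussSum.

Lemma closure_Fp q : prime q -> exists (K : closedFieldType), 
   inhabited {rmorphism 'F_q -> K} /\ q \in [pchar K].
Proof.
move=> q_pr; have [K [f _]] := countable_algebraic_closure 'F_q.
by exists K; split; [split | apply: (rmorph_pchar f); apply: pchar_Fp].
Qed.

Lemma pchar_odd_opp1 (K : fieldType) q : q \in [pchar K] -> odd q -> (2%:R : K) != 0.
Proof.
move=> qK q_odd; rewrite -(dvdn_pcharf qK).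
have q_pr := pcharf_prime qK.
by rewrite dvdn_prime2 //; apply: contraTneq q_odd => ->.
Qed.

Lemma sign_inj (K : fieldType) : (2%:R : K) != 0 ->
  injective (fun b : bool => (-1) ^+ b : K).
Proof.
move=> K2; have N1 : (-1 == 1 :> K) = false.
  by rewrite -subr_eq0 -opprD oppr_eq0 -mulr2n; apply: negbTE.
by case=> [] [] //= /eqP; rewrite expr1 expr0 ?N1 // eq_sym N1.
Qed.

Lemma qnr_rmorph q (K : fieldType) (f : {rmorphism 'F_q -> K}) (x : int) :
  prime q -> odd q -> ~~ (q %| x)%Z ->
  (x%:~R : K) ^+ q.-1./2 = (-1) ^+ qnr q x.
Proof.
move=> q_pr q_odd qx; have := congr1 f (qnrE q_pr q_odd qx).
by rewrite rmorphXn /= rmorph_int rmorph_sign.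
Qed.

Lemma half_pred_odd n : odd n -> n.-1./2 = n./2.
Proof. by case: n => //= n; rewrite uphalf_half => /negbTE ->. Qed.

Lemma odd_half_pred n : odd n -> odd n.-1./2 = (n %% 4 == 3)%N.
Proof. lia. Qed.

(** Over an algebraic closure of F_q, the power G^q of the Gauss sum G for p is computed twice: by
    Frobenius, and as G (G^2)^((q-1)/2), where Euler's criterion gives the character modulo q of
    (-1/p) p. *)
Lemma quadratic_reciprocity p q : prime p -> odd p -> prime q -> odd q -> p != q ->
  qnr p q (+) qnr q p = (p %% 4 == 3)%N && (q %% 4 == 3)%N.
Proof.
move=> p_pr p_odd q_pr q_odd pq.
have [K [[f] qK]] := closure_Fp q_pr.
have K2 := pchar_odd_opp1 qK q_odd.
have qp : ~~ (q %| p)%N by rewrite dvdn_prime2 // eq_sym.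
have pq' : ~~ (p %| q)%N by rewrite dvdn_prime2.
have p0 : (p%:R : K) != 0 by rewrite -(dvdn_pcharf qK).
have /closed_rootP[z] : size (\poly_(i < p) (1 : K)) != 1%N.
  by rewrite size_poly_eq ?oner_neq0 // neq_ltn prime_gt1 ?orbT.
rewrite /root horner_poly => /eqP; under eq_bigr do rewrite mul1r.
move=> sz; have zp : z ^+ p = 1.
  by apply/eqP; rewrite -subr_eq0 subrX1 sz mulr0.
have G2 := gauss_sum_sq p_pr p_odd K2 sz zp.
have Gq := gauss_sum_Frobenius p_pr p_odd zp q_odd qK pq'.
have charE (x : int) : ~~ (p %| x)%Z -> quad_char K (x%:~R : 'F_p) = (-1) ^+ qnr p x.
  by move=> px; rewrite /quad_char Fp_eq0 // px mul1r.
have := charE (-1); rewrite rmorphN1 => EN1.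
have pN1 : ~~ (p %| -1)%Z by rewrite dvdzE dvdn1 neq_ltn prime_gt1 ?orbT.
rewrite {}EN1 // qnrN1 // in G2.
have /= := charE q pq'; rewrite -pmulrn => Eq; rewrite {}Eq in Gq.
have G0 : gauss_sum p z != 0.
  by rewrite -sqrf_eq0 G2 mulf_neq0 ?signr_eq0.
move: Gq; rewrite -{1}(odd_double_half q) q_odd add1n exprS mulrC => /(mulIf G0).
rewrite -muln2 mulnC exprM G2 exprMn.
rewrite -half_pred_odd //.
have /= := qnr_rmorph f q_pr q_odd (x := p) qp; rewrite -pmulrn => ->.
rewrite -exprM -[X in X * _]signr_odd oddM => E.
have E' : (-1) ^+ ((p %% 4 == 3)%N && (q %% 4 == 3)%N) = (-1) ^+ (qnr p q (+) qnr q p) :> K.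
  rewrite signr_addb -E -mulrA -signr_addb addbb mulr1; congr (_ ^+ nat_of_bool _).
  by rewrite oddb odd_half_pred.
by apply: (sign_inj K2).
Qed.

(** For an eighth root of unity z with z^4 = -1, t = z + 1/z is a square root of 2, and Frobenius
    sends it to z^p + 1/z^p, which is t or -t according to p modulo 8. *)
Lemma qnr2 p : prime p -> odd p -> qnr p 2 = (p %% 8 == 3)%N || (p %% 8 == 5)%N.
Proof.
move=> p_pr p_odd.
have [K [[f] pK]] := closure_Fp p_pr.
have K2 := pchar_odd_opp1 pK p_odd.
have /closed_rootP[z] : size ('X^4 + 1%:P : {poly K}) != 1%N.
  by rewrite size_polyDl ?size_polyXn // size_polyC oner_eq0.
rewrite /root hornerD hornerXn hornerC addr_eq0 => /eqP z4.
have z8 : z ^+ 8 = 1 by rewrite (exprM z 4 2) z4 sqrrN expr1n.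
pose t := z + z ^+ 7.
have t2 : t ^+ 2 = 2.
  rewrite /t sqrrD -exprS z8 -exprM -[(7*2)%N]/(8 + 6)%N exprD z8 mul1r.
  rewrite (exprD z 4 2) z4 mulN1r addrAC subrr add0r //.
have t0 : t != 0 by rewrite -sqrf_eq0 t2.
have tp : t ^+ p = (-1) ^+ ((p %% 8 == 3)%N || (p %% 8 == 5)%N) * t.
  rewrite -(pFrobenius_autE pK) rmorphD /= !pFrobenius_autE -exprM mulnC exprM.
  rewrite -(expr_mod p z8) /t.
  have : odd (p %% 8) by move: p_odd; lia.
  have : (p %% 8 < 8)%N by rewrite ltn_mod.
  have zz (n : nat) : z ^+ (n + 4) = - z ^+ n by rewrite exprD z4 mulrN1.
  move: (p %% 8)%N; case=> [|[|[|[|[|[|[|[|r]]]]]]]] //= _ _.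
  - by rewrite expr1 mul1r.
  - rewrite -exprM -[(3 * 7)%N]/(8 + 8 + 1 + 4)%N zz !exprD z8 !mul1r expr1.
    by rewrite mulN1r (zz 3) opprD opprK addrC.
  - rewrite -exprM -[(5 * 7)%N]/(8 + 8 + 8 + 8 + 3)%N !exprD z8 !mul1r.
    by rewrite mulN1r (zz 3) (zz 1) opprD opprK.
  - rewrite -exprM -[(7 * 7)%N]/(8 + 8 + 8 + 8 + 8 + 8 + 1)%N !exprD z8 !mul1r.
    by rewrite expr1 addrC.
apply: (sign_inj K2) => /=.
have p2 : ~~ (p %| 2)%Z.
  by rewrite dvdzE /=; apply/negP => /(dvdn_leq (isT : (0 < 2)%N)); rewrite leqNgt odd_prime_gt2.
rewrite -(qnr_rmorph f p_pr p_odd p2) /=.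
apply: (mulIf t0); rewrite -tp -{2}(odd_double_half p) p_odd add1n exprSr -muln2 mulnC exprM t2.
by rewrite half_pred_odd.
Qed.

(** * Hilbert symbols and the product formula *)

Definition upart (p : nat) (x : int) : int := (x %/ (p ^ logn p `|x|)%N)%Z.

Lemma upart_unique (p k : nat) (x u : int) : prime p -> ~~ (p %| u)%Z ->
  x = (p ^ k)%N%:Z * u -> logn p `|x| = k /\ upart p x = u.
Proof.
move=> p_pr pu xE.
have u0 : (0 < `|u|)%N by rewrite absz_gt0; apply: contraNneq pu => ->; rewrite dvdz0.
have pk0 : (0 < p ^ k)%N by rewrite expn_gt0 prime_gt0.
have vx : logn p `|x| = k.
  rewrite xE abszM lognM //= pfactorK //.
  have -> : logn p `|u| = 0%N; last by rewrite addn0.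
  by apply/eqP; rewrite -leqn0 leqNgt -pfactor_dvdn // expn1 -dvdzE.
split=> //; rewrite /upart vx xE mulKz //.
by rewrite -lt0n.
Qed.

Lemma upartP (p : nat) (x : int) : prime p -> x != 0 ->
  ~~ (p %| upart p x)%Z /\ x = (p ^ logn p `|x|)%N%:Z * upart p x.
Proof.
move=> p_pr x0; have x0' : (0 < `|x|)%N by rewrite absz_gt0.
have E : x = (p ^ logn p `|x|)%N%:Z * upart p x.
  by rewrite mulrC /upart divzK // dvdzE /= pfactor_dvdnn.
split=> //; apply/negP=> /dvdzP[u uE].
have : (p ^ (logn p `|x|).+1 %| `|x|)%N.
  have -> : (p ^ (logn p `|x|).+1 %| `|x|)%N = ((p ^ (logn p `|x|).+1)%N %| x)%Z.
    by rewrite dvdzE.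
  by apply/dvdzP; exists u; rewrite {1}E uE expnSr PoszM mulrCA.
by rewrite pfactor_dvdn // ltnn.
Qed.

Lemma upartM (p : nat) (x y : int) : prime p -> x != 0 -> y != 0 ->
  logn p `|x * y| = (logn p `|x| + logn p `|y|)%N /\
  upart p (x * y) = upart p x * upart p y.
Proof.
move=> p_pr x0 y0; have [px xE] := upartP p_pr x0; have [py yE] := upartP p_pr y0.
apply: upart_unique => //.
  have p0 := pchar_Fp p_pr.
  by rewrite !(dvdz_pcharf p0) in px py *; rewrite rmorphM mulf_eq0 negb_or px.
by rewrite {1}xE {1}yE mulrACA expnD PoszM.
Qed.

Lemma upart_unit (p : nat) (x : int) : prime p -> ~~ (p %| x)%Z ->
  logn p `|x| = 0%N /\ upart p x = x.
Proof. by move=> p_pr px; apply: upart_unique => //; rewrite expn0 mul1r. Qed.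

(* Signs are booleans, true standing for -1, so that symbols multiply by addb.
   The class of x modulo squares is given at an odd p by the parity of its
   valuation and the residue character of its unit part u, and at 2 by the
   parity and the characters (-1)^((u-1)/2) and (-1)^((u^2-1)/8) of u. *)
Definition ocls (p : nat) (x : int) : bool * bool :=
  (odd (logn p `|x|), qnr p (upart p x)).
Definition dcls (x : int) : bool * (bool * bool) :=
  (odd (logn 2 `|x|), ((upart 2 x %% 4)%Z == 3,
    ((upart 2 x %% 8)%Z == 3) || ((upart 2 x %% 8)%Z == 5))).
Arguments ocls : simpl never.
Arguments dcls : simpl never.

Definition oadd (x y : bool * bool) := (x.1 (+) y.1, x.2 (+) y.2).
Definition dadd (x y : bool * (bool * bool)) := (x.1 (+) y.1, oadd x.2 y.2).
(** The explicit formulas for the Hilbert symbol of p^i u and p^j v, written additively. At an odd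
    p, with [d] the character of -1, it is i j d + i chi(v) + j chi(u); at 2, [dsym] is eps(u)
    eps(v) + i omega(v) + j omega(u). *)
Definition osym (d : bool) (x y : bool * bool) : bool :=
  [&& x.1, y.1 & d] (+) (x.1 && y.2) (+) (y.1 && x.2).
Definition dsym (x y : bool * (bool * bool)) : bool :=
  (x.2.1 && y.2.1) (+) (x.1 && y.2.2) (+) (y.1 && x.2.2).
Definition hilb (p : nat) (x y : int) : bool :=
  osym (qnr p (-1)) (ocls p x) (ocls p y).
Definition hilb2 (x y : int) : bool := dsym (dcls x) (dcls y).

Lemma oclsM p x y : prime p -> odd p -> x != 0 -> y != 0 ->
  ocls p (x * y) = oadd (ocls p x) (ocls p y).
Proof.
move=> p_pr p_odd x0 y0; have [px _] := upartP p_pr x0; have [py _] := upartP p_pr y0.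
by rewrite /ocls /oadd; have [-> ->] := upartM p_pr x0 y0; rewrite oddD qnrM.
Qed.

Lemma odd_unit_mod8 (u : int) : ~~ (2 %| u)%Z ->
  [|| (u %% 8)%Z == 1, (u %% 8)%Z == 3, (u %% 8)%Z == 5 | (u %% 8)%Z == 7].
Proof. lia. Qed.

Lemma dclsM x y : x != 0 -> y != 0 -> dcls (x * y) = dadd (dcls x) (dcls y).
Proof.
move=> x0 y0; have [/odd_unit_mod8 px _] := upartP (isT : prime 2) x0.
have [/odd_unit_mod8 py _] := upartP (isT : prime 2) y0.
rewrite /dcls /dadd; have [-> ->] := upartM (isT : prime 2) x0 y0; rewrite oddD /oadd /=.
move: (upart 2 x) (upart 2 y) px py => u v pu pv.
have m4 (w : int) : (w %% 4)%Z = ((w %% 8)%Z %% 4)%Z by lia.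
rewrite !(m4 (_ * _)) (m4 u) (m4 v) -!(modzMml u) -!(modzMmr _ v).
by case/or4P: pu => /eqP ->; case/or4P: pv => /eqP ->.
Qed.

Lemma oclsN1 p : prime p -> ocls p (-1) = (false, qnr p (-1)).
Proof.
move=> p_pr; have pN1 : ~~ (p %| -1)%Z by rewrite dvdzE dvdn1 neq_ltn prime_gt1 ?orbT.
by rewrite /ocls; have [-> ->] := upart_unit p_pr pN1.
Qed.

Lemma ocls_prime p q : prime p -> prime q -> odd p ->
  ocls p q = if p == q then (true, false) else (false, qnr p q).
Proof.
move=> p_pr q_pr p_odd; rewrite /ocls; case: eqP => [<-|/eqP pq].
  have p1 : ~~ (p %| 1)%Z by rewrite dvdzE dvdn1 neq_ltn prime_gt1 ?orbT.
  have [|-> ->] := @upart_unique p 1 p 1 p_pr p1; first by rewrite mulr1 expn1.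
  by rewrite qnr1.
have pq' : ~~ (p %| q%:Z)%Z by rewrite dvdzE dvdn_prime2.
by have [-> ->] := upart_unit p_pr pq'.
Qed.

Lemma dclsN1 : dcls (-1) = (false, (true, false)).
Proof. by rewrite /dcls; have [||-> ->] := @upart_unit 2 (-1). Qed.

Lemma dcls2 : dcls 2 = (true, (false, false)).
Proof. by rewrite /dcls; have [|||-> ->] := @upart_unique 2 1 2 1. Qed.

Lemma dcls_odd (q : nat) : odd q ->
  dcls q = (false, ((q %% 4 == 3)%N, (q %% 8 == 3)%N || (q %% 8 == 5)%N)).
Proof.
by move=> q_odd; rewrite /dcls; have [||-> ->] := @upart_unit 2 q;
  rewrite ?dvdzE ?dvdn2 ?negbK ?modz_nat.
Qed.

Lemma osymC d x y : osym d x y = osym d y x.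
Proof. by rewrite /osym; case: x y d => [[] []] [[] []] []. Qed.

Lemma dsymC x y : dsym x y = dsym y x.
Proof. by rewrite /dsym; case: x y => [[] [[] []]] [[] [[] []]]. Qed.

Lemma osymDl d x y z : osym d (oadd x y) z = osym d x z (+) osym d y z.
Proof. by rewrite /osym; case: x y z d => [[] []] [[] []] [[] []] []. Qed.

Lemma dsymDl x y z : dsym (dadd x y) z = dsym x z (+) dsym y z.
Proof. by rewrite /dsym; case: x y z => [[] [[] []]] [[] [[] []]] [[] [[] []]]. Qed.

Lemma hilbC p x y : hilb p x y = hilb p y x.
Proof. exact: osymC. Qed.

Lemma hilb2C x y : hilb2 x y = hilb2 y x.
Proof. exact: dsymC. Qed.

Lemma hilbMl p x y z : prime p -> odd p -> x != 0 -> y != 0 ->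
  hilb p (x * y) z = hilb p x z (+) hilb p y z.
Proof. by move=> *; rewrite /hilb oclsM // osymDl. Qed.

Lemma hilb2Ml x y z : x != 0 -> y != 0 ->
  hilb2 (x * y) z = hilb2 x z (+) hilb2 y z.
Proof. by move=> *; rewrite /hilb2 dclsM // dsymDl. Qed.

Lemma hilb_unit p x y : prime p -> ~~ (p %| x)%Z -> ~~ (p %| y)%Z -> hilb p x y = false.
Proof.
by move=> p_pr px py; rewrite /hilb /ocls; have [-> _] := upart_unit p_pr px;
  have [-> _] := upart_unit p_pr py.
Qed.

(** The cut-off loses nothing once [B] exceeds |x| and |y|, because the symbol of two units at an
    odd prime is trivial. *)
Definition hilb_total B x y : bool :=
  ((x < 0) && (y < 0)) (+) hilb2 x y (+)
  \big[addb/false]_(p < B | prime p && odd p) hilb p x y.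

Lemma hilb_totalC B x y : hilb_total B x y = hilb_total B y x.
Proof.
rewrite /hilb_total andbC hilb2C; congr (_ (+) _); apply: eq_bigr => p _.
exact: hilbC.
Qed.

Lemma hilb_totalMl B x y z : x != 0 -> y != 0 ->
  hilb_total B (x * y) z = hilb_total B x z (+) hilb_total B y z.
Proof.
move=> x0 y0; rewrite /hilb_total hilb2Ml //.
set S := \big[addb/false]_(_ < _ | _) hilb _ x z.
set T := \big[addb/false]_(_ < _ | _) hilb _ y z.
have -> : \big[addb/false]_(p < B | prime p && odd p) hilb p (x * y) z = S (+) T.
  by rewrite -big_split /=; apply: eq_bigr => p /andP[p_pr p_odd]; rewrite hilbMl.
rewrite mulr_lt0 x0 y0 /=.
by move: S T (x < 0) (y < 0) (z < 0) (hilb2 x z) (hilb2 y z); do 7!case.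
Qed.

(** Since the symbols are bimultiplicative, this reduces the product formula to the generators -1
    and the primes. *)
Lemma int_mul_ind (P : int -> Prop) : P (-1) -> (forall p : nat, prime p -> P p) ->
  (forall x y, x != 0 -> y != 0 -> P x -> P y -> P (x * y)) ->
  forall x, x != 0 -> P x.
Proof.
move=> PN1 Pp PM; have P1 : P 1 by rewrite -[1]mulr1 -mulrNN; apply: PM.
have Pn (n : nat) : (0 < n)%N -> P n.
  elim/ltn_ind: n => n IH n0; have [n1|n1] := leqP n 1.
    by have -> : n = 1%N by apply/eqP; rewrite eqn_leq n1.
  have p_pr := pdiv_prime n1; rewrite -(divnK (pdiv_dvd n)) PoszM.
  have d0 : (0 < n %/ pdiv n)%N by rewrite divn_gt0 ?pdiv_gt0 // dvdn_leq // pdiv_dvd.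
  apply: PM; last exact: Pp.
  - by rewrite -absz_gt0.
  - by rewrite -absz_gt0 prime_gt0.
  by apply: IH => //; rewrite ltn_Pdiv // prime_gt1.
case=> n n0; first by apply: Pn; rewrite lt0n.
by rewrite NegzE -mulN1r; apply: PM => //; apply: Pn.
Qed.

Lemma big_hilb_only B x y q : (q < B)%N -> prime q -> odd q ->
  (forall p, prime p -> odd p -> p != q -> hilb p x y = false) ->
  \big[addb/false]_(p < B | prime p && odd p) hilb p x y = hilb q x y.
Proof.
move=> qB q_pr q_odd F0; rewrite (bigD1 (Ordinal qB)) /= ?q_pr //.
rewrite big1 ?addbF // => p /andP[/andP[p_pr p_odd] pq].
exact: F0.
Qed.

Lemma prime_ndvdz p q : prime p -> prime q -> p != q -> ~~ (p %| q%:Z)%Z.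
Proof. by move=> p_pr q_pr pq; rewrite dvdzE dvdn_prime2. Qed.

Lemma prime_ndvdzN1 p : prime p -> ~~ (p %| -1)%Z.
Proof. by move=> p_pr; rewrite dvdzE dvdn1 neq_ltn prime_gt1 ?orbT. Qed.

Lemma hilb_total_N1 B y : y != 0 -> (`|y| < B)%N -> hilb_total B (-1) y = false.
Proof.
move: y; apply: int_mul_ind => [|q q_pr|x y x0 y0 Px Py].
- move=> _; rewrite /hilb_total /hilb2 dclsN1 big1 // => p /andP[p_pr p_odd].
  by rewrite hilb_unit ?prime_ndvdzN1.
- move=> qB; rewrite /hilb_total /hilb2 dclsN1.
  have [q_odd|/(prime_oddPn q_pr) q2] := boolP (odd q); last first.
    rewrite q2 dcls2 big1 // => p /andP[p_pr p_odd]; rewrite hilb_unit ?prime_ndvdzN1 //.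
    by apply: prime_ndvdz => //; apply: contraTneq p_odd => ->.
  rewrite (@big_hilb_only _ _ _ q) //.
  + rewrite dcls_odd // /hilb oclsN1 // ocls_prime // eqxx qnrN1 //.
    by case: (_ == _).
  by move=> p p_pr p_odd pq; rewrite hilb_unit ?prime_ndvdzN1 // prime_ndvdz.
- move=> xyB; rewrite hilb_totalC hilb_totalMl // !(hilb_totalC _ _ (-1)).
  rewrite Px ?Py //; apply: leq_ltn_trans xyB; rewrite abszM.
    by rewrite leq_pmull // absz_gt0.
  by rewrite leq_pmulr // absz_gt0.
Qed.

(** For distinct odd primes only the places 2, p and q contribute, and the sum is the reciprocity
    law. The pair 2, q is the supplementary law for 2, and p = q odd is the one for -1. *)
Lemma hilb_total_primes B p q : prime p -> prime q -> (p < B)%N -> (q < B)%N ->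
  hilb_total B p q = false.
Proof.
have T2 q' : prime q' -> (q' < B)%N -> odd q' -> hilb_total B 2 q' = false.
  move=> q_pr qB q_odd.
  rewrite /hilb_total /hilb2 dcls2 dcls_odd //.
  rewrite (@big_hilb_only _ _ _ q') //.
  + rewrite /hilb !ocls_prime // eqxx; have -> : (q' == 2) = false.
      by apply: contraTF q_odd => /eqP ->.
    by rewrite qnr2 // /osym /dsym /=; case: (_ || _).
  move=> p' p_pr p_odd pq; rewrite hilb_unit // ?prime_ndvdz //.
  by apply: contraTneq p_odd => ->.
move=> p_pr q_pr pB qB.
have [p_odd|/(prime_oddPn p_pr) p2] := boolP (odd p); last first.
  have [q_odd|/(prime_oddPn q_pr) q2] := boolP (odd q); first by rewrite p2 T2.
  rewrite p2 q2 /hilb_total /hilb2 dcls2 big1 // => r /andP[r_pr r_odd].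
  by rewrite hilb_unit // prime_ndvdz //; apply: contraTneq r_odd => ->.
have [q_odd|/(prime_oddPn q_pr) q2] := boolP (odd q); last first.
  by rewrite q2 hilb_totalC T2.
rewrite /hilb_total /hilb2 !dcls_odd //.
have [<-|pq] := eqVneq p q.
  rewrite (@big_hilb_only _ _ _ p) //.
  + rewrite /hilb !ocls_prime // eqxx qnrN1 //.
    by rewrite /osym /dsym /=; case: (_ == _).
  by move=> r r_pr r_odd rp; rewrite hilb_unit ?prime_ndvdz.
rewrite (bigD1 (Ordinal pB)) ?p_pr //= (bigD1 (Ordinal qB)) ?q_pr ?q_odd //=; last first.
  by rewrite -val_eqE /= eq_sym.
rewrite big1 => [|r /andP[/andP[/andP[r_pr r_odd] rp] rq]]; last first.
  by rewrite hilb_unit ?prime_ndvdz.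
rewrite /hilb !ocls_prime // !eqxx [q == p]eq_sym (negbTE pq).
rewrite /osym /dsym /=; have := quadratic_reciprocity p_pr p_odd q_pr q_odd pq.
by case: (qnr p q) (qnr q p) (_ && _) => [] [] [].
Qed.

Theorem hilb_product_formula B x y : x != 0 -> y != 0 ->
  (`|x| < B)%N -> (`|y| < B)%N -> hilb_total B x y = false.
Proof.
move=> x0 y0 xB yB; move: x x0 xB; apply: int_mul_ind.
- by move=> _; apply: hilb_total_N1.
- move=> p p_pr pB; move: y y0 yB; apply: int_mul_ind.
  + by move=> _; rewrite hilb_totalC hilb_total_N1 //= -lt0n prime_gt0.
  + by move=> q q_pr qB; apply: hilb_total_primes.
  move=> x y x0 y0 Px Py xyB.
  rewrite hilb_totalC hilb_totalMl // !(hilb_totalC _ _ p).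
  rewrite Px ?Py //; apply: leq_ltn_trans xyB; rewrite abszM.
    by rewrite leq_pmull // absz_gt0.
  by rewrite leq_pmulr // absz_gt0.
move=> x x' x0 x0' Px Px' xxB; rewrite hilb_totalMl // Px ?Px' //;
  apply: leq_ltn_trans xxB; rewrite abszM.
  by rewrite leq_pmull // absz_gt0.
by rewrite leq_pmulr // absz_gt0.
Qed.

Lemma ocls_sq p x : prime p -> odd p -> x != 0 -> ocls p (x ^+ 2) = (false, false).
Proof. by move=> p_pr p_odd x0; rewrite expr2 oclsM // /oadd !addbb. Qed.

Lemma oclsM_sq p x y : prime p -> odd p -> x != 0 -> y != 0 ->
  ocls p (x * y ^+ 2) = ocls p x.
Proof.
move=> p_pr p_odd x0 y0; rewrite oclsM ?expf_neq0 // ocls_sq // /oadd !addbF.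
by case: ocls.
Qed.

(* The valuation of x - y can be odd only if the leading terms of x and y cancel. *)
Lemma qnr_upart_sub p x y : prime p -> odd p -> x != 0 -> y != 0 ->
  ~~ (ocls p x).1 -> ~~ (ocls p y).1 -> (ocls p (x - y)).1 ->
  (ocls p x).2 = (ocls p y).2.
Proof.
move=> p_pr p_odd x0 y0; rewrite /ocls /=.
have [px xE] := upartP p_pr x0; have [py yE] := upartP p_pr y0.
move: (logn p `|x|) (logn p `|y|) (upart p x) (upart p y) xE yE px py.
move=> i j u w xE yE pu pw vi vj vxy.
have shift (e : nat) (t : int) : ~~ (p %| t)%Z -> x - y = (p ^ e)%N%:Z * t -> odd e.
  by move=> pt E; move: vxy; have [-> _] := upart_unique p_pr pt E.
have split (a b : nat) (s t : int) : (a < b)%N -> ~~ (p %| s)%Z ->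
   exists r, ~~ (p %| r)%Z /\ (p ^ a)%N%:Z * s + (p ^ b)%N%:Z * t = (p ^ a)%N%:Z * r.
  move=> ab ps; exists (s + (p ^ (b - a))%N%:Z * t); split.
    by rewrite rpredDr // dvdz_mulr // dvdzE /= dvdn_exp // subn_gt0.
  by rewrite mulrDr mulrA -PoszM -expnD subnKC // ltnW.
have [ij|ji|ij] := ltngtP i j.
- have [r [pr E]] := split i j u (- w) ij pu.
  by have := shift i r pr; rewrite xE yE -E mulrN (negbTE vi) => /(_ erefl).
- have pNw : ~~ (p %| - w)%Z by rewrite rpredN.
  have [r [pr E]] := split j i (- w) u ji pNw.
  by have := shift j r pr; rewrite xE yE -E mulrN addrC (negbTE vj) => /(_ erefl).
apply: eq_qnr => //; apply: contraNT vi => puw; apply: shift puw _.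
by rewrite xE yE -ij mulrBr.
Qed.

(** The essential case [T] has a of odd and b of even valuation. There z^2 - b y^2 = a x^2 has odd
    valuation, so the leading terms of z^2 and b y^2 cancel and the unit part of b is a residue. *)
Lemma hilb_solution p (a b x y z : int) : prime p -> odd p -> a != 0 -> b != 0 ->
  [|| x != 0, y != 0 | z != 0] -> z ^+ 2 = a * x ^+ 2 + b * y ^+ 2 ->
  hilb p a b = false.
Proof.
move=> p_pr p_odd.
have T (a' b' x' y' z' : int) : a' != 0 -> b' != 0 ->
    [|| x' != 0, y' != 0 | z' != 0] -> z' ^+ 2 = a' * x' ^+ 2 + b' * y' ^+ 2 ->
    (ocls p a').1 -> ~~ (ocls p b').1 -> hilb p a' b' = false.
  move: a' b' x' y' z' => {}a {}b {}x {}y {}z a0 b0 nz E va vb.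
  suff eb : (ocls p b).2 = false by rewrite /hilb /osym eb (negbTE vb) andbF.
  have [y0|y0] := eqVneq y 0.
    move: E nz; rewrite y0 expr0n /= mulr0 addr0 ?eqxx /=.
    have [-> /eqP|x0 E _] := eqVneq x 0.
      by rewrite expr0n /= mulr0 sqrf_eq0 => ->.
    have z0 : z != 0 by rewrite -sqrf_eq0 E mulf_neq0 // expf_neq0.
    by move: va; rewrite -(oclsM_sq p_pr p_odd a0 x0) -E ocls_sq.
  have by0 : b * y ^+ 2 != 0 by rewrite mulf_neq0 // expf_neq0.
  have [z0|z0] := eqVneq z 0.
    move: E; rewrite z0 expr0n /= => /esym/eqP; rewrite addr_eq0 => /eqP E.
    have x0 : x != 0.
      by apply: contraNneq by0 => x0; rewrite -oppr_eq0 -E x0 expr0n mulr0.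
    move: va; rewrite -(oclsM_sq p_pr p_odd a0 x0) E -mulN1r oclsM //.
    by rewrite oclsN1 // oclsM_sq // => vb'; case/negP: vb.
  have [x0|x0] := eqVneq x 0.
    rewrite x0 expr0n /= mulr0 add0r in E.
    by rewrite -(oclsM_sq p_pr p_odd b0 y0) -E ocls_sq.
  rewrite -(oclsM_sq p_pr p_odd b0 y0) -(@qnr_upart_sub p (z ^+ 2)) ?expf_neq0 //.
  - by rewrite ocls_sq.
  - by rewrite ocls_sq.
  - by rewrite oclsM_sq.
  by rewrite E addrK oclsM_sq.
move=> a0 b0 nz E.
have [va|va] := boolP (ocls p a).1; have [vb|vb] := boolP (ocls p b).1.
- have ab0 : - (a * b) != 0 by rewrite oppr_eq0 mulf_neq0.
  have cab : ocls p (- (a * b)) = oadd (false, qnr p (-1)) (oadd (ocls p a) (ocls p b)).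
    by rewrite -[- (a * b)]mulN1r oclsM ?mulf_neq0 // oclsN1 // oclsM.
  (* (a, b) = (a, -ab), and -ab has even valuation. *)
  have : hilb p a (- (a * b)) = false.
    apply: (T a (- (a * b)) z y (a * x)) => //.
    - move: nz; rewrite mulf_eq0 (negbTE a0).
      by move: (x == 0) (y == 0) (z == 0); do 3!case.
    - by rewrite exprMn E; ring.
    - by rewrite cab; move: va vb; case: ocls => [[] []]; case: ocls => [[] []].
  rewrite /hilb cab; move: va vb.
  by case: (ocls p a) => [[] []]; case: (ocls p b) => [[] []]; case: (qnr p (-1)).
- exact: T E va vb.
- rewrite hilbC; apply: (T b a y x z) => //; last by rewrite addrC; exact: E.
  by move: nz; move: (x == 0) (y == 0) (z == 0); do 3!case.
by rewrite /hilb /osym (negbTE va) (negbTE vb).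
Qed.

(** * Ternary equations *)

Lemma sqrt_mod_squarefree (m : nat) (a : int) : (0 < m)%N ->
  (forall p, prime p -> ~~ (p ^ 2 %| m)%N) ->
  (forall p : nat, prime p -> (p %| m)%N -> exists s : int, (p %| s ^+ 2 - a)%Z) ->
  exists t : int, (m %| t ^+ 2 - a)%Z.
Proof.
elim/ltn_ind: m => m IH m0 sqf sq; have [m1|m1] := leqP m 1.
  by exists 0; have -> : m = 1%N by apply/eqP; rewrite eqn_leq m1.
have p_pr := pdiv_prime m1; set p := pdiv m in p_pr.
have mE : m = (p * (m %/ p))%N by rewrite mulnC divnK // pdiv_dvd.
set k := (m %/ p)%N in mE.
have k0 : (0 < k)%N by rewrite divn_gt0 ?pdiv_gt0 // dvdn_leq // pdiv_dvd.
have cpk : coprime p k.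
  rewrite prime_coprime //; apply: contra (sqf p p_pr) => pk.
  by rewrite mE expnS expn1 dvdn_pmul2l ?prime_gt0.
have [t kt] : exists t : int, (k %| t ^+ 2 - a)%Z.
  apply: IH => //; first by rewrite ltn_Pdiv // prime_gt1.
    by move=> q q_pr; apply: contra (sqf q q_pr) => qk; rewrite mE dvdn_mull.
  by move=> q q_pr qk; apply: sq => //; rewrite mE dvdn_mull.
have [s ps] := sq p p_pr (pdiv_dvd m).
have cz : coprimez p k by [].
exists (zchinese p k s t); rewrite mE PoszM Gauss_dvdz //.
have D (d : nat) (u v : int) : (u = v %[mod d])%Z -> (d %| v ^+ 2 - a)%Z -> (d %| u ^+ 2 - a)%Z.
  move=> uv; rewrite -!eqz_mod_dvd => /eqP <-.
  by rewrite -modzXm uv modzXm.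
apply/andP; split.
  by apply: D ps; apply: zchinese_modl.
by apply: D kt; apply: zchinese_modr.
Qed.

Lemma small_residue (m : nat) (t : int) : (0 < m)%N ->
  exists s : int, (m %| s - t)%Z /\ (2 * `|s| <= m)%N.
Proof.
move=> m0; have [h|h] := leqP (2 * `|(t %% m)%Z|) m.
  exists (t %% m)%Z; split=> //; rewrite -eqz_mod_dvd modz_mod //.
exists ((t %% m)%Z - m%:Z); split.
  by rewrite addrAC rpredB ?dvdzz // -eqz_mod_dvd modz_mod.
have := ltz_pmod t (d := m); have := modz_ge0 t (d := m); move: h; lia.
Qed.

(* Descent on |a| + |b|: for square-free a and b with |a| <= |b|, a is a square
   s^2 modulo b with |s| <= |b| / 2, and c := (s^2 - a) / b, which has the same
   symbols against a as b, is smaller than b. *)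
Theorem ternary_Hasse (a b : int) : a != 0 -> b != 0 ->
  (forall p, prime p -> odd p -> hilb p a b = false) -> ~~ ((a < 0) && (b < 0)) ->
  exists x y z : int, [|| x != 0, y != 0 | z != 0] /\
    z ^+ 2 = a * x ^+ 2 + b * y ^+ 2.
Proof.
move: {2}(_ + _)%N (leqnn (`|a| + `|b|)%N) => n; elim: n a b => [|n IH] a b.
  by rewrite leqn0 addn_eq0 !absz_eq0 => /andP[->].
move=> abn a0 b0 hab sab.
wlog ab : a b a0 b0 hab sab abn / (`|a| <= `|b|)%N.
  move=> W; have [ab|/ltnW ba] := leqP `|a|%N `|b|%N; first exact: W.
  have [|||x [y [z [nz E]]]] := W b a b0 a0 _ _ _ ba.
  - by move=> p p_pr p_odd; rewrite hilbC hab.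
  - by rewrite andbC.
  - by rewrite addnC.
  exists y, x, z; split; last by rewrite addrC.
  by move: nz; move: (x == 0) (y == 0) (z == 0); do 3!case.
(* Dropping a square factor changes no symbol and lowers the measure, so the descent may assume both
   coefficients square-free. *)
have square_step (c d : int) (k : nat) : (1 < k)%N -> c != 0 -> d != 0 ->
    (`|(c * k%:Z ^+ 2)%R| + `|d| <= n.+1)%N -> ~~ ((c * k%:Z ^+ 2 < 0) && (d < 0)) ->
    (forall p, prime p -> odd p -> hilb p (c * k%:Z ^+ 2) d = false) ->
    exists x y z : int, [|| x != 0, y != 0 | z != 0] /\
      z ^+ 2 = c * k%:Z ^+ 2 * x ^+ 2 + d * y ^+ 2.
  move=> k1 c0 d0 cdn scd hcd.
  have k0 : k%:Z != 0 by rewrite -absz_gt0 ltnW.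
  have [|||x [y [z [nz E]]]] := IH c d _ c0 d0.
  - rewrite -ltnS; apply: leq_trans cdn; rewrite ltn_add2r abszM.
    rewrite -[ltnLHS]muln1 ltn_pmul2l ?absz_gt0 // abszX /=.
    by rewrite -{1}(exp1n 2) ltn_exp2r.
  - move=> p p_pr p_odd; rewrite -(hcd p) //.
    by rewrite /hilb oclsM_sq.
  - move: scd; rewrite pmulr_llt0 //; first by rewrite exprn_gt0 // ltz_nat ltnW.
  exists x, (k%:Z * y), (k%:Z * z); split.
    by rewrite !mulf_eq0 (negbTE k0).
  by rewrite !exprMn E; ring.
have [/existsP[k /andP[k_pr ka]]|/existsPn a_sqf] :=
  boolP [exists k : 'I_`|a|.+1, prime k && (k ^ 2 %| `|a|)%N].
  have [c aE] : exists c, a = c * k%:Z ^+ 2.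
    by apply/dvdzP; rewrite dvdzE abszX.
  have c0 : c != 0 by apply: contraNneq a0 => c0; rewrite aE c0 mul0r.
  have := square_step c b k (prime_gt1 k_pr) c0 b0; rewrite -aE; exact.
have [/existsP[k /andP[k_pr kb]]|/existsPn b_sqf] :=
  boolP [exists k : 'I_`|b|.+1, prime k && (k ^ 2 %| `|b|)%N].
  have [c bE] : exists c, b = c * k%:Z ^+ 2.
    by apply/dvdzP; rewrite dvdzE abszX.
  have c0 : c != 0 by apply: contraNneq b0 => c0; rewrite bE c0 mul0r.
  have := square_step c a k (prime_gt1 k_pr) c0 a0; rewrite -bE => H.
  have [||| x [y [z [nz E]]]] := H.
  - by rewrite addnC.
  - by rewrite andbC.
  - by move=> p p_pr p_odd; rewrite hilbC hab.
  exists y, x, z; split; last by rewrite addrC.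
  by move: nz; move: (x == 0) (y == 0) (z == 0); do 3!case.
have [b1|b1] := leqP `|b|%N 1.
  have [-> | b'] := eqVneq b 1.
    by exists 0, 1, 1; split => //; ring.
  have bN : b < 0 by move: b1 b0 b'; lia.
  have -> : a = 1 by move: sab a0 ab b1; rewrite bN andbT; lia.
  by exists 1, 0, 1; split => //; ring.
have sqb (p : nat) : prime p -> (p %| `|b|)%N -> ~~ (p ^ 2 %| `|b|)%N.
  move=> p_pr pb; have pB : (p < `|b|.+1)%N by rewrite ltnS dvdn_leq // absz_gt0.
  by have := b_sqf (Ordinal pB); rewrite /= p_pr.
have [t bt] : exists t : int, (`|b|%N %| t ^+ 2 - a)%Z.
  apply: sqrt_mod_squarefree; first by rewrite absz_gt0.
    move=> p p_pr; apply/negP=> p2b.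
    have pb : (p %| `|b|)%N by apply: dvdn_trans p2b; rewrite dvdn_exp.
    by have := sqb p p_pr pb; rewrite p2b.
  move=> p p_pr pb.
  have [pa|pa] := boolP (p %| a)%Z.
    by exists 0; rewrite expr0n sub0r rpredN.
  (* Modulo 2 every integer is a square, so the descent asks for no condition at 2. *)
  have [p_odd|/(prime_oddPn p_pr) p2] := boolP (odd p); last first.
    exists 1; move: pa; rewrite p2; lia.
  suff /(qnr_square p_pr p_odd pa)[s ps] : ~~ qnr p a.
    by exists s; rewrite -rpredN opprB.
  have vb : logn p `|b| = 1%N.
    apply/eqP; rewrite eqn_leq -pfactor_dvdn ?absz_gt0 // expn1 pb andbT.
    by rewrite leqNgt -pfactor_dvdn ?absz_gt0 // sqb.
  have := hab p p_pr p_odd; rewrite /hilb /osym /ocls vb.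
  by have [-> ->] := upart_unit p_pr pa; rewrite /= => ->.
have b_gt0 : (0 < `|b|)%N by rewrite absz_gt0.
have [s [st sb]] := small_residue t b_gt0.
have {t bt st} : (b %| s ^+ 2 - a)%Z.
  have absb (k : int) : (`|b|%N %| k)%Z = (b %| k)%Z by rewrite !dvdzE.
  rewrite !absb in bt st; rewrite -[s ^+ 2](subrK (t ^+ 2)) -addrA rpredD //.
  by rewrite subr_sqr dvdz_mulr.
case/dvdzP=> c cE.
have sE : s ^+ 2 = a + c * b by rewrite -cE addrC subrK.
have [c0|c0] := eqVneq c 0.
  exists 1, 0, s; split=> //; rewrite sE c0; ring.
have cb0 : c * b != 0 by rewrite mulf_neq0.
(* |c| |b| <= s^2 + |a| <= |b|^2 / 4 + |b|, which is less than |b|^2 as soon as |b| >= 2. *)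
have cb : (`|c| < `|b|)%N.
  have : (`|c| * `|b| <= `|s| ^ 2 + `|a|)%N.
    by rewrite -abszM -cE -abszX; lia.
  rewrite ltnNge => le_cb; apply/negP => le_bc.
  have sq_bc : (`|b| * `|b| <= `|c| * `|b|)%N by rewrite leq_mul2r le_bc orbT.
  have sq_sb : ((2 * `|s|) ^ 2 <= `|b| ^ 2)%N by rewrite leq_sqr.
  have b2 : (2 * `|b| <= `|b| * `|b|)%N by rewrite leq_mul2r b1 orbT.
  rewrite expnMn -[(`|b| ^ 2)%N]mulnn in sq_sb.
  by move: le_cb sq_bc sq_sb b2 b_gt0 ab; lia.
have [|||x [y [z [nz E]]]] := IH a c _ a0 c0.
- by rewrite -ltnS; apply: leq_trans abn; rewrite ltn_add2l.
(* s^2 = a + c b is itself a solution, so a and c b have trivial symbol, and the symbol of a and c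
   equals that of a and b. *)
- move=> p p_pr p_odd; have := hilb_solution p_pr p_odd a0 cb0 (x := 1) (y := 1) (z := s) isT.
  rewrite !expr1n !mulr1 => /(_ sE); rewrite hilbC hilbMl // ![hilb p _ a]hilbC.
  by rewrite hab // addbF.
- apply: contra sab => /andP[an cn]; rewrite an /=.
  have : 0 < c * b by rewrite -cE subr_gt0 (lt_le_trans an) // sqr_ge0.
  by rewrite nmulr_rgt0.
have [y0|y0] := eqVneq y 0.
  by exists x, 0, z; split; [move: nz; rewrite y0 | rewrite E y0; ring].
(* Norms from Q(sqrt a) multiply: (z + x sqrt a)(s + sqrt a) has norm (c y^2)(c b) = b (c y)^2. *)
exists (z + x * s), (c * y), (z * s + a * x); split.
  by rewrite mulf_eq0 (negbTE c0) (negbTE y0) orbT.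
have -> : b * (c * y) ^+ 2 = (c * b) * (c * y ^+ 2) by ring.
have -> : c * y ^+ 2 = z ^+ 2 - a * x ^+ 2 by rewrite E; ring.
rewrite -cE; ring.
Qed.

(** * Primes with prescribed quadratic characters *)

(** Summation by parts against the bounded partial sums of [chi]. Monotonicity is asked only from
    [m] on because one of the weights used, log n / n, starts to decrease late. *)
Lemma abel_bound (R : realFieldType) (chi w : nat -> R) C m k :
  (forall a b, `|\sum_(a <= i < b) chi i| <= C) ->
  (forall i, (m <= i)%N -> w i.+1 <= w i) -> (forall i, (m <= i)%N -> 0 <= w i) ->
  `|\sum_(m <= i < k) chi i * w i| <= C * w m.
Proof.
move=> chiC wN w0; have C0 : 0 <= C by apply: le_trans (chiC 0%N 0%N).
have [km|mk] := leqP k m; first by rewrite big_geq // normr0 mulr_ge0 // w0.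
pose A j := \sum_(m <= i < j) chi i.
have -> : \sum_(m <= i < k) chi i * w i =
    A k * w k + \sum_(m <= i < k) A i.+1 * (w i - w i.+1).
  rewrite -(subnKC (ltnW mk)); elim: (k - m)%N => [|j IH].
    by rewrite addn0 !big_geq // /A big_geq // mul0r addr0.
  rewrite addnS !big_nat_recr ?leq_addr //= IH /A !big_nat_recr ?leq_addr //=.
  by ring.
have -> : C * w m = C * w k + \sum_(m <= i < k) C * (w i - w i.+1).
  rewrite -mulr_sumr -mulrDr; congr (C * _).
  have := telescope_sumr w (ltnW mk).
  rewrite -[in X in X -> _](opprK (\sum_(m <= i < k) _)) -sumrN.
  under eq_bigr do rewrite opprB.
  by move=> H; rewrite -[\sum_(_ <= _ < _) _]opprK H; ring.
apply: le_trans (ler_normD _ _) _; apply: lerD.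
  by rewrite normrM ler_pM ?chiC // ger0_norm ?w0 // ltnW.
apply: le_trans (ler_norm_sum _ _ _) _; rewrite big_nat [leRHS]big_nat.
apply: ler_sum => i /andP[mi _].
by rewrite normrM ler_pM ?chiC // ger0_norm ?subr_ge0 ?wN.
Qed.

Lemma sum_multiples (R : nmodType) (F : nat -> R) d N : (0 < d)%N ->
  \sum_(1 <= m < N.+1 | (d %| m)%N) F m = \sum_(1 <= k < (N %/ d).+1) F (d * k)%N.
Proof.
move=> d0; elim: N => [|N IH]; first by rewrite div0n !big_geq.
rewrite big_mkcond big_nat_recr //= -big_mkcond /= IH divnS //.
case: ifP => [dN|_]; last by rewrite add0n addr0.
rewrite add1n [RHS]big_nat_recr //=; congr (_ + _); congr F.
have -> : (N %/ d).+1 = (N.+1 %/ d)%N by rewrite divnS // dN.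
by rewrite mulnC divnK.
Qed.

(** * Non-vanishing of L(1, chi) for a real character, through finite sums *)

Section Nonvanishing.
Variables (R : archiRealFieldType) (chi : nat -> R) (C : R).
Hypothesis chi1 : chi 1 = 1.
Hypothesis chiM : forall m n, chi (m * n)%N = chi m * chi n.
Hypothesis chi_val : forall n, [\/ chi n = 0, chi n = 1 | chi n = -1].
Hypothesis chi_sum : forall a b, `|\sum_(a <= i < b) chi i| <= C.

Lemma chi_le1 n : `|chi n| <= 1.
Proof. by case: (chi_val n) => ->; rewrite ?normr0 ?normrN ?normr1. Qed.

Lemma chi_bound_ge0 : 0 <= C.
Proof. by apply: le_trans (chi_sum 0 0). Qed.

Definition Lsum N : R := \sum_(1 <= n < N.+1) chi n / n%:R.

Lemma Lsum_diff m k : (m <= k)%N -> `|Lsum k - Lsum m| <= C / m.+1%:R.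
Proof.
move=> mk; rewrite /Lsum (@big_cat_nat _ _ _ m.+1 1 k.+1) //= addrAC subrr add0r.
apply: (@abel_bound _ _ (fun n => n%:R^-1)) => // i mi; last by rewrite invr_ge0.
by rewrite lef_pV2 ?posrE ?ltr0n ?ler_nat //; apply: leq_trans mi.
Qed.

(** The convolution of [chi] with 1, whose values are the coefficients of zeta(s) L(s, chi). *)
Definition divsum n : R := \sum_(1 <= d < n.+1 | (d %| n)%N) chi d.

Lemma divsum_wide n N : (0 < n <= N)%N ->
  \sum_(1 <= d < N.+1 | (d %| n)%N) chi d = divsum n.
Proof.
case/andP=> n0 nN; rewrite /divsum (big_cat_nat (n := n.+1)) //=.
rewrite [X in _ + X]big_nat_cond [X in _ + X]big1 ?addr0 // => i /andP[/andP[ni _]].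
by move/(dvdn_leq n0); rewrite leqNgt ni.
Qed.

Lemma divsum_prime_step p m k : prime p -> ~~ (p %| m)%N -> (0 < m)%N ->
  divsum (p ^ k.+1 * m) = chi p * divsum (p ^ k * m) + divsum m.
Proof.
move=> p_pr pm m0; have p0 := prime_gt0 p_pr.
have pk0 : (0 < p ^ k * m)%N by rewrite muln_gt0 expn_gt0 p0.
set N := (p ^ k.+1 * m)%N; have NE : N = (p * (p ^ k * m))%N by rewrite mulnA -expnS.
rewrite {1}/divsum (bigID (fun d => p %| d)%N) /=; congr (_ + _).
  rewrite (eq_bigl (fun d => (p %| d)%N && (d %| N)%N)); last by move=> d; rewrite andbC.
  rewrite big_mkcondr /= sum_multiples // /divsum mulr_sumr [in RHS]big_mkcond /=.
  rewrite {1}NE mulKn //; apply: eq_bigr => d _.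
  by rewrite NE dvdn_pmul2l // chiM.
rewrite -(@divsum_wide m N); last by rewrite m0 /N leq_pmull // expn_gt0 p0.
apply: eq_bigl => d; apply/andP/idP => [[dN pd]|dm].
  by move: dN; rewrite Gauss_dvdr // coprime_sym coprimeXl // prime_coprime.
by split; [rewrite dvdn_mull | apply: contra pm => /dvdn_trans; apply].
Qed.

(** The factor contributed by p^k is 1 + chi(p) + ... + chi(p)^k. It is 1, k + 1, or alternately 1
    and 0, hence never negative, and at least 1 when k is even. *)
Lemma divsum_prime_power p m k : prime p -> ~~ (p %| m)%N -> (0 < m)%N ->
  0 <= divsum m ->
  0 <= divsum (p ^ k * m) /\ divsum m <= divsum (p ^ k.*2 * m).
Proof.
move=> p_pr pm m0 r0; have step := divsum_prime_step _ p_pr pm m0.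
have E0 : divsum (p ^ 0 * m) = divsum m by rewrite mul1n.
case: (chi_val p) => cp.
- have H j : divsum (p ^ j * m) = divsum m.
    by case: j => [|j]; rewrite ?E0 // step cp mul0r add0r.
  by rewrite !H.
- have H j : divsum m <= divsum (p ^ j * m).
    elim: j => [|j IH]; first by rewrite E0.
    by rewrite step cp mul1r lerDr (le_trans r0).
  by split; [apply: le_trans (H k) | apply: H].
have H j : divsum (p ^ j * m) = if odd j then 0 else divsum m.
  elim: j => [|j IH]; rewrite ?E0 // step cp IH /=.
  by case: odd => /=; rewrite ?mulr0 ?add0r // mulN1r addNr.
by rewrite !H odd_double; split => //; case: odd.
Qed.

Lemma divsum_pos n : (0 < n)%N -> 0 <= divsum n /\ 1 <= divsum (n ^ 2).
Proof.
elim/ltn_ind: n => n IH n0; have [n1|n1] := leqP n 1.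
  have -> : n = 1%N by apply/eqP; rewrite eqn_leq n1.
  by rewrite /divsum big_mkcond big_nat1 /= chi1.
have p_pr := pdiv_prime n1; set p := pdiv n in p_pr.
have [m cpm nE] := pfactor_coprime p_pr n0; set k := logn p n in nE.
have m0 : (0 < m)%N by move: n0; rewrite nE muln_gt0 => /andP[].
have pm : ~~ (p %| m)%N by rewrite -prime_coprime.
have mn : (m < n)%N.
  rewrite [ltnRHS]nE -{1}[m]muln1 ltn_pmul2l // -{1}(expn0 p) ltn_exp2l ?prime_gt1 //.
  by rewrite logn_gt0 mem_primes p_pr n0 pdiv_dvd.
have [rm rm2] := IH m mn m0.
have [r1 _] := divsum_prime_power k p_pr pm m0 rm.
have pm2 : ~~ (p %| m ^ 2)%N by rewrite Euclid_dvdX // andbT.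
have m20 : (0 < m ^ 2)%N by rewrite expn_gt0 m0.
have [_ r2] := divsum_prime_power k p_pr pm2 m20 (le_trans ler01 rm2).
split; first by rewrite nE mulnC.
by rewrite nE mulnC expnMn -expnM muln2 (le_trans rm2).
Qed.

Lemma sum_squares_le (F : nat -> R) K : (forall n, (0 < n)%N -> 0 <= F n) ->
  \sum_(1 <= k < K.+1) F (k ^ 2)%N <= \sum_(1 <= m < (K ^ 2).+1) F m.
Proof.
move=> F0; elim: K => [|K IH]; first by rewrite !big_geq.
rewrite big_nat_recr //= [leRHS](@big_cat_nat _ _ _ (K ^ 2).+1) //=; last first.
  by rewrite ltnS; apply: leq_mul.
rewrite lerD // [leRHS](@big_cat_nat _ _ _ (K.+1 ^ 2)) //=; last first.
  by apply: ltn_mul.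
rewrite big_nat1 lerDr big_nat sumr_ge0 // => i /andP[Ki _].
by apply: F0; apply: leq_trans Ki.
Qed.

(** * The Lambert series of the character at a fixed t *)

Section Lambert.
Variable t : R.
Hypothesis t01 : 0 < t < 1.
Let t0 : 0 < t. Proof. by case/andP: t01. Qed.
Let t1 : t < 1. Proof. by case/andP: t01. Qed.

(** Stands for (1 - t^n) / (1 - t) without a division. *)
Definition geom n : R := \sum_(i < n) t ^+ i.

Lemma geomS n : geom n.+1 = geom n + t ^+ n.
Proof. by rewrite /geom big_ord_recr. Qed.

Lemma geomE n : (1 - t) * geom n = 1 - t ^+ n.
Proof. by rewrite -opprB mulNr -subrX1 opprB. Qed.

Lemma geomSl n : geom n.+1 = 1 + t * geom n.
Proof. by have := geomE n; rewrite geomS => E; lra. Qed.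

Lemma geom_ge1 n : 1 <= geom n.+1.
Proof.
by rewrite geomSl lerDl mulr_ge0 ?(ltW t0) // sumr_ge0 // => i _; rewrite exprn_ge0 // ltW.
Qed.

Lemma bernoulli n : 1 - n%:R * (1 - t) <= t ^+ n.
Proof.
elim: n => [|n IH]; first by rewrite mul0r subr0 expr0.
rewrite exprS -natr1; have n0 : 0 <= n%:R :> R by apply: ler0n.
have := ler_wpM2l (ltW t0) IH; have : 0 <= n%:R * (1 - t) ^+ 2 by rewrite mulr_ge0 // sqr_ge0.
by nra.
Qed.

(** Bernoulli's inequality summed over the exponents below n. *)
Lemma geom_ge n : n%:R * (2%:R - (n%:R - 1) * (1 - t)) <= 2%:R * geom n.
Proof.
elim: n => [|n IH]; first by rewrite mul0r /geom big_ord0 mulr0.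
rewrite geomS -natr1; have := bernoulli n; lra.
Qed.

(** This is what the monotonicity of [lambert_gap] amounts to: consecutive gaps differ by 1/(n(n+1))
    - t^n / (geom n geom (n+1)). In the induction the right side grows by geom (n+2) t^(n+1) (1 +
    t), which [geom_ge] bounds below. *)
Lemma geom_prod n : n.+1%:R * n.+2%:R * t ^+ n.+1 <= geom n.+1 * geom n.+2.
Proof.
elim: n => [|n IH]; first by rewrite /geom !big_ord_recr big_ord0 /= !expr0 !expr1; have := t1; lra.
have -> : geom n.+2 * geom n.+3 =
   geom n.+1 * geom n.+2 + geom n.+2 * t ^+ n.+1 * (1 + t).
  by rewrite !geomS !exprS; ring.
apply: le_trans (lerD IH (lexx _)).
have := geom_ge n.+2; rewrite -!natr1 [t ^+ n.+2]exprS.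
have T0 : 0 < t ^+ n.+1 by rewrite exprn_gt0.
move: (t ^+ n.+1) T0 (geom n.+2) (ler0n R n) => T T0 G; move: (n%:R : R) => x x0 HG.
have H : (x + 1 + 1) * (2 - (x + 1) * (1 - t)) * (1 + t) <= 2 * G * (1 + t).
  apply: ler_wpM2r; [move: t0; lra | move: HG; lra].
suff : (x + 1 + 1) * (x + 1 + 1 + 1) * t <= (x + 1) * (x + 1 + 1) + G * (1 + t).
  by move/(ler_wpM2l (ltW T0)); lra.
have u0 : 0 <= 1 - t by move: t1; lra.
have : 0 <= (x + 1 + 1) * (x + 1) * (1 - t) ^+ 2 by rewrite !mulr_ge0 //; lra.
have : 0 <= (x + 1 + 1) * (1 - t) by rewrite mulr_ge0 //; lra.
move: H; lra.
Qed.

(* Monsky: up to the factor 1 - t, this is 1 / (n (1 - t)) - t^n / (1 - t^n), so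
   that summing it against chi compares the Lambert series of chi, whose power
   series coefficients are divsum, with L(1, chi) / (1 - t). *)
Definition lambert_gap n : R := n%:R^-1 - t ^+ n / geom n.

Lemma lambert_gap_ge0 n : (1 <= n)%N -> 0 <= lambert_gap n.
Proof.
case: n => // n _; have G1 := geom_ge1 n.
rewrite subr_ge0 ler_pdivrMr ?(lt_le_trans ltr01) // mulrC ler_pdivlMr ?ltr0n //.
rewrite mulr_natr /geom -[X in _ *+ X]card_ord -sumr_const; apply: ler_sum => i _.
by rewrite ler_wiXn2l ?ltW // ltnW.
Qed.

Lemma lambert_gap_noninc n : (1 <= n)%N -> lambert_gap n.+1 <= lambert_gap n.
Proof.
case: n => // n _; have G1 := geom_ge1 n; have G2 := geom_ge1 n.+1.
have G10 : 0 < geom n.+1 by apply: lt_le_trans G1.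
have G20 : 0 < geom n.+2 by apply: lt_le_trans G2.
rewrite -subr_ge0.
have -> : lambert_gap n.+1 - lambert_gap n.+2 =
    (n.+1%:R * n.+2%:R)^-1 - t ^+ n.+1 / (geom n.+1 * geom n.+2).
  rewrite /lambert_gap [t ^+ n.+2]exprS; have E := geomSl n.+1.
  have E2 : n.+2%:R = n.+1%:R + 1 :> R by rewrite natr1.
  have N1 : n.+1%:R != 0 :> R by rewrite pnatr_eq0.
  have N2 : n.+2%:R != 0 :> R by rewrite pnatr_eq0.
  have Ea : t * geom n.+1 = geom n.+2 - 1 by rewrite E addrC addKr.
  have -> : t * t ^+ n.+1 / geom n.+2 = t ^+ n.+1 / geom n.+1 - t ^+ n.+1 / (geom n.+1 * geom n.+2).
    have -> : t * t ^+ n.+1 / geom n.+2 = t ^+ n.+1 * (t * geom n.+1) / (geom n.+1 * geom n.+2).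
      by field; rewrite !gt_eqF.
    by rewrite Ea; field; rewrite !gt_eqF.
  have -> : (n.+1%:R * n.+2%:R)^-1 = n.+1%:R^-1 - n.+2%:R^-1 :> R.
    have inv_sub (a b : R) : a != 0 -> b != 0 -> a^-1 - b^-1 = (b - a) / (a * b).
      by move=> a0 b0; field; rewrite a0 b0.
    have E3 : n.+2%:R - n.+1%:R = 1 :> R by rewrite E2 addrAC subrr add0r.
    by rewrite inv_sub // E3 mul1r.
  ring.
rewrite subr_ge0 ler_pdivrMr ?mulr_gt0 // mulrC ler_pdivlMr ?mulr_gt0 ?ltr0n //.
by rewrite mulrC geom_prod.
Qed.

(** After exchanging the sums, each inner geometric series splits into 1/d, the gap at d and a
    truncation tail. The first parts add up to [Lsum N]; partial summation bounds the second by C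
    times the gap at 1, which is 1 - t; each of the N tails is at most t^N. *)
Lemma divsum_power_bound N :
  (1 - t) * (\sum_(1 <= m < N.+1) divsum m * t ^+ m) <=
  `|Lsum N| + C * (1 - t) + N%:R * t ^+ N.
Proof.
have -> : \sum_(1 <= m < N.+1) divsum m * t ^+ m =
    \sum_(1 <= d < N.+1) chi d * \sum_(1 <= k < (N %/ d).+1) t ^+ (d * k).
  transitivity (\sum_(1 <= m < N.+1) \sum_(1 <= d < N.+1)
      if (d %| m)%N then chi d * t ^+ m else 0).
    rewrite big_nat [RHS]big_nat; apply: eq_bigr => m /andP[m0 mN].
    by rewrite -(@divsum_wide m N) ?m0 // mulr_suml -big_mkcond.
  rewrite exchange_big_nat big_nat [RHS]big_nat; apply: eq_bigr => d /andP[d0 _].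
  by rewrite -big_mkcond /= sum_multiples // mulr_sumr.
have inner d : (0 < d)%N -> (1 - t) * \sum_(1 <= k < (N %/ d).+1) t ^+ (d * k) =
    t ^+ d / geom d - t ^+ (d * (N %/ d).+1) / geom d.
  case: d => // d _; set K := (N %/ d.+1)%N.
  have G0 : geom d.+1 != 0 by rewrite gt_eqF // (lt_le_trans ltr01) // geom_ge1.
  have E : (1 - t ^+ d.+1) * \sum_(1 <= k < K.+1) t ^+ (d.+1 * k) =
      t ^+ d.+1 - t ^+ (d.+1 * K.+1).
    elim: K => [|K IH]; first by rewrite big_geq // muln1 subrr mulr0.
    by rewrite big_nat_recr //= mulrDr IH !mulnS !exprD; ring.
  by rewrite -mulrBl -E -geomE; field.
rewrite mulr_sumr.
have -> : \sum_(1 <= d < N.+1) (1 - t) * (chi d * \sum_(1 <= k < (N %/ d).+1) t ^+ (d * k)) =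
   Lsum N - \sum_(1 <= d < N.+1) chi d * lambert_gap d
    - \sum_(1 <= d < N.+1) chi d * (t ^+ (d * (N %/ d).+1) / geom d).
  rewrite /Lsum -!sumrB big_nat [RHS]big_nat; apply: eq_bigr => d /andP[d0 _].
  by rewrite mulrCA inner // /lambert_gap; ring.
apply: le_trans (ler_norm _) _; apply: le_trans (ler_normB _ _) _; apply: lerD.
  apply: le_trans (ler_normB _ _) _; apply: lerD => //.
  have -> : 1 - t = lambert_gap 1.
    by rewrite /lambert_gap invr1 expr1 /geom big_ord1 expr0 divr1.
  apply: abel_bound => // i; [exact: lambert_gap_noninc|exact: lambert_gap_ge0].
apply: le_trans (ler_norm_sum _ _ _) _.
have -> : N%:R * t ^+ N = \sum_(1 <= d < N.+1) t ^+ N.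
  by rewrite sumr_const_nat subn1 mulr_natl.
rewrite big_nat [leRHS]big_nat; apply: ler_sum => d /andP[d0 _].
case: d d0 => // d _; have G1 := geom_ge1 d.
have G0 : 0 < geom d.+1 by apply: lt_le_trans G1.
have T0 k : 0 <= t ^+ k by rewrite exprn_ge0 // ltW.
rewrite normrM -[leRHS]mul1r ler_pM ?chi_le1 // ger0_norm ?divr_ge0 ?(ltW G0) //.
rewrite ler_pdivrMr // -[leLHS]mulr1 ler_pM // ler_wiXn2l ?ltW //.
by rewrite mulnC ltnW // ltn_ceil.
Qed.

End Lambert.
(* Otherwise the sum of t^(k^2), which divsum dominates, would stay bounded as
   t tends to 1. *)
Lemma Lsum_large : exists N, C / N.+1%:R < `|Lsum N|.
Proof.
have sum_le (v c a b : R) : a <= v -> b <= v -> a + c * v + b <= v * (c + 2%:R).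
  by move=> av bv; lra.
have half_le (v a b : R) : v * (2%:R * a) = 1 -> b * v <= a * v -> 2%:R^-1 <= 1 - b * v.
  by move=> va bv; lra.
have C0 := chi_bound_ge0.
(* If |Lsum N| were small, then with u = 1 - t [divsum_power_bound] would give u K/2 <= u + C u + u,
   that is, K <= 2 C + 4. *)
pose K := (Num.bound (2%:R * C + 4%:R)).+1.
have KC : 2%:R * C + 4%:R < K%:R.
  have /archi_boundP H : 0 <= 2%:R * C + 4%:R by lra.
  by apply: lt_trans H _; rewrite ltr_nat.
(* With t = 1 - 1/T, the choice T = 2 K^2 keeps t^(k^2) >= 1/2 for all k <= K. In M the summand K T
   gives C / (N + 1) <= 1/T and the summand 2 T^3 gives N t^N <= 1/T; N is twice M so that t^N is
   the square of t^M. *)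
pose T := (2 * K ^ 2)%N; pose M := (2 * T ^ 3 + K * T)%N; pose N := (2 * M)%N.
exists N; rewrite ltNge; apply/negP => small.
have T2 : (2 <= T)%N by rewrite /T /K; nia.
have Tp : 0 < T%:R :> R by rewrite ltr0n ltnW.
pose u : R := T%:R^-1; pose t := 1 - u.
have u0 : 0 < u by rewrite invr_gt0.
have uT : u * T%:R = 1 by rewrite mulVf // gt_eqF.
have u12 : u <= 2%:R^-1 by rewrite lef_pV2 ?posrE // ler_nat.
have t01 : 0 < t < 1 by apply/andP; rewrite /t; split; lra.
have t0 : 0 < t by case/andP: t01.
have := divsum_power_bound t01 N.
have tE : 1 - t = u by rewrite /t; lra.
rewrite tE.
have CN : C / N.+1%:R <= u.
  rewrite ler_pdivrMr ?ltr0n // mulrC -ler_pdivrMr // /u invrK.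
  have : C <= K%:R by lra.
  move/(ler_wpM2r (ltW Tp))/le_trans; apply; rewrite -natrM ler_nat /N /M.
  by apply: leqW; apply: (@leq_trans M); rewrite ?leq_addl // leq_pmull.
have tN : N%:R * t ^+ N <= u.
  (* Because t (1 + u) = 1 - u^2 <= 1, while (1 + u)^M >= M u. *)
  have tM : t ^+ M * (M%:R * u) <= 1.
    have : (t * (1 + u)) ^+ M <= 1.
      apply: exprn_ile1; last by rewrite /t; nra.
      by rewrite mulr_ge0 ?ltW //; lra.
    rewrite exprMn; apply: le_trans; rewrite ler_wpM2l ?exprn_ge0 ?(ltW t0) //.
    elim: (M) => [|j IH]; first by rewrite mul0r expr0 ler01.
    rewrite exprS -natr1 mulrDl mul1r [X in _ <= X]mulrDl mul1r.
    rewrite lerD // ler_peMr ?(ltW u0) //.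
    by rewrite exprn_ege1 // lerDl ltW.
  have tM0 : 0 <= t ^+ M by rewrite exprn_ge0 // ltW.
  rewrite /N mulnC exprM natrM.
  have MT : 2%:R * T%:R ^+ 3 <= M%:R :> R.
    by rewrite -natrX -natrM ler_nat leq_addr.
  move: (t ^+ M) tM tM0 => z tM z0.
  have zT : z * (2%:R * T%:R ^+ 2) <= 1.
    apply: le_trans tM; rewrite ler_wpM2l //.
    have := ler_wpM2r (ltW u0) MT; rewrite exprSr -!mulrA [T%:R * u]mulrC uT mulr1.
    by apply: le_trans.
  have zM (a v w : R) : v * w = 1 -> a * 2%:R * z ^+ 2 = z * (a * v) * (2%:R * z * w).
    by move=> vw; rewrite -[LHS]mulr1 -vw; ring.
  have zT2 (v w : R) : v * w = 1 -> 2%:R * z * w = z * (2%:R * w ^+ 2) * v.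
    by move=> vw; rewrite -[LHS]mulr1 -vw; ring.
  rewrite (zM _ _ _ uT).
  apply: (@le_trans _ _ (2%:R * z * T%:R)).
    by rewrite -[leRHS]mul1r ler_wpM2r // !mulr_ge0 // ltW.
  by rewrite (zT2 _ _ uT) -[leRHS]mul1r ler_wpM2r // ltW.
have LB : K%:R / 2%:R <= \sum_(1 <= m < N.+1) divsum m * t ^+ m.
  have pos m : (0 < m)%N -> 0 <= divsum m * t ^+ m.
    move=> m0; have [H _] := divsum_pos m0.
    by rewrite mulr_ge0 // exprn_ge0 // ltW.
  have KN : (K ^ 2 <= N)%N.
    apply: (@leq_trans T); first by rewrite leq_pmull.
    apply: (@leq_trans (K * T)); first by rewrite leq_pmull.
    by apply: (@leq_trans M); rewrite ?leq_addl // leq_pmull.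
  apply: (@le_trans _ _ (\sum_(1 <= m < (K ^ 2).+1) divsum m * t ^+ m)); last first.
    rewrite [leRHS](@big_cat_nat _ _ _ (K ^ 2).+1) //= lerDl big_nat sumr_ge0 // => i /andP[Ki _].
    by apply: pos; apply: leq_trans Ki.
  apply: le_trans (sum_squares_le K pos).
  have -> : K%:R / 2%:R = \sum_(1 <= k < K.+1) 2%:R^-1 :> R.
    by rewrite sumr_const_nat subn1 /= -[RHS]mulr_natl.
  rewrite big_nat [leRHS]big_nat; apply: ler_sum => k /andP[k0 kK].
  have [_ H] := divsum_pos k0.
  have tk : 2%:R^-1 <= t ^+ (k ^ 2).
    apply: le_trans (bernoulli t01 _); rewrite tE.
    have : (k ^ 2)%:R <= (K ^ 2)%:R :> R by rewrite ler_nat leq_exp2r.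
    move/(ler_wpM2r (ltW u0)); apply: half_le.
    by rewrite -natrM.
  by rewrite -[leLHS]mul1r ler_pM ?invr_ge0.
move/(le_trans (ler_wpM2l (ltW u0) LB))/le_trans.
move/(_ _ (sum_le _ _ _ _ (le_trans small CN) tN)); rewrite ler_pM2l //.
by apply/negP; rewrite -ltNge ltr_pdivlMr // mulrDl [C * _]mulrC -natrM.
Qed.

(** Non-vanishing of L(1, chi) stated without a limit: by [Lsum_diff], later partial sums stay
    within C / (N1 + 1) of the large one found above. *)
Lemma Lsum_away : exists d N1, 0 < d /\
  forall N, (N1 <= N)%N -> d <= `|Lsum N|.
Proof.
have [N1 H] := Lsum_large; exists (`|Lsum N1| - C / N1.+1%:R), N1.
split=> [|N NN1]; first by rewrite subr_gt0.
have := Lsum_diff NN1; rewrite lerBlDr => D.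
rewrite -[Lsum N1](subrK (Lsum N)); apply: le_trans (ler_normD _ _) _.
by rewrite addrC lerD2l distrC.
Qed.
End Nonvanishing.

(** * Chebyshev's bound and Mertens' estimates *)

(* ell stands for the logarithm. *)
Section Mertens.
Variables (R : archiRealFieldType) (ell : nat -> R).
Hypothesis ellM : forall m n, (0 < m)%N -> (0 < n)%N -> ell (m * n) = ell m + ell n.
Hypothesis ell_incr : forall n, (0 < n)%N -> 0 <= ell n.+1 - ell n <= n%:R^-1.
Hypothesis ell2 : 0 < ell 2.

Lemma ell1 : ell 1 = 0.
Proof. by have := @ellM 1 1 isT isT; rewrite muln1 => E; lra. Qed.

Lemma ell_mono m n : (0 < m <= n)%N -> ell m <= ell n.
Proof.
case/andP=> m0 mn; rewrite -(subnKC mn); elim: (n - m)%N => [|j IH].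
  by rewrite addn0.
rewrite addnS; apply: le_trans IH _; rewrite -subr_ge0.
have mj : (0 < m + j)%N by rewrite addn_gt0 m0.
by case/andP: (ell_incr mj).
Qed.

Lemma ell_ge0 n : (0 < n)%N -> 0 <= ell n.
Proof. by move=> n0; rewrite -ell1 ell_mono. Qed.

Lemma ellX n k : (0 < n)%N -> ell (n ^ k) = k%:R * ell n.
Proof.
move=> n0; elim: k => [|k IH]; first by rewrite mul0r ell1.
by rewrite expnS ellM ?expn_gt0 ?n0 // IH -natr1; ring.
Qed.

Lemma ell_unbounded (x : R) : exists n, (0 < n)%N /\ x < ell n.
Proof.
have [x0|x0] := ltP x 0; first by exists 1%N; rewrite ell1.
have /archi_boundP : 0 <= x / ell 2 by rewrite divr_ge0 // ltW.
rewrite ltr_pdivrMr // => H; exists (2 ^ Num.bound (x / ell 2))%N.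
by rewrite expn_gt0 ellX.
Qed.

(* The sum of Lambda(m) F(m) over the prime powers m = p ^ k with p, k <= y. *)
Definition mangoldt_sum y (F : nat -> R) : R :=
  \sum_(1 <= p < y.+1 | prime p) ell p * \sum_(1 <= k < y.+1) F (p ^ k)%N.

Lemma eq_mangoldt_sum y F G : (forall n, (1 < n)%N -> F n = G n) ->
  mangoldt_sum y F = mangoldt_sum y G.
Proof.
move=> FG; apply: eq_bigr => p p_pr; congr (_ * _).
rewrite big_nat [RHS]big_nat; apply: eq_bigr => k /andP[k0 _].
by rewrite FG // -(expn0 p) ltn_exp2l // prime_gt1.
Qed.

Lemma mangoldt_sumD y F G :
  mangoldt_sum y (fun n => F n + G n) = mangoldt_sum y F + mangoldt_sum y G.
Proof. by rewrite -big_split; apply: eq_bigr => p _; rewrite big_split mulrDr. Qed.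

Lemma mangoldt_sumZ y c F : mangoldt_sum y (fun n => c * F n) = c * mangoldt_sum y F.
Proof. by rewrite mulr_sumr; apply: eq_bigr => p _; rewrite -mulr_sumr mulrCA. Qed.

Lemma mangoldt_sum_sum y (I : finType) (F : I -> nat -> R) :
  mangoldt_sum y (fun n => \sum_i F i n) = \sum_i mangoldt_sum y (F i).
Proof.
rewrite exchange_big; apply: eq_bigr => p _; rewrite -mulr_sumr; congr (_ * _).
by rewrite exchange_big.
Qed.

Lemma mangoldt_sum_nat y (a b : nat) (f : nat -> nat -> R) (P : nat -> pred nat) :
  mangoldt_sum y (fun m => \sum_(a <= n < b | P m n) f m n) =
  \sum_(a <= n < b) mangoldt_sum y (fun m => if P m n then f m n else 0).
Proof.
rewrite exchange_big; apply: eq_bigr => p _; rewrite -mulr_sumr; congr (_ * _).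
by rewrite exchange_big; apply: eq_bigr => k _; rewrite big_mkcond.
Qed.

Lemma ler_mangoldt_sum y F G : (forall n, (0 < n)%N -> F n <= G n) ->
  mangoldt_sum y F <= mangoldt_sum y G.
Proof.
move=> FG; apply: ler_sum => p p_pr; apply: ler_wpM2l.
  by rewrite ell_ge0 // prime_gt0.
by apply: ler_sum => k _; apply: FG; rewrite expn_gt0 prime_gt0.
Qed.

Lemma ler_norm_mangoldt_sum y F :
  `|mangoldt_sum y F| <= mangoldt_sum y (fun n => `|F n|).
Proof.
apply: le_trans (ler_norm_sum _ _ _) _; apply: ler_sum => p p_pr.
rewrite normrM ger0_norm ?ell_ge0 ?prime_gt0 // ler_wpM2l ?ell_ge0 ?prime_gt0 //.
exact: ler_norm_sum.
Qed.

Lemma mangoldt_sum_widen y z F : (y <= z)%N -> (forall n, (0 < n)%N -> 0 <= F n) ->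
  mangoldt_sum y F <= mangoldt_sum z F.
Proof.
move=> yz F0; have Fp p k : prime p -> 0 <= F (p ^ k)%N.
  by move=> p_pr; rewrite F0 // expn_gt0 prime_gt0.
rewrite /mangoldt_sum [leRHS](@big_cat_nat _ _ _ y.+1) //=.
apply: (@le_trans _ _ (\sum_(1 <= p < y.+1 | prime p) ell p * \sum_(1 <= k < z.+1) F (p ^ k)%N)).
  apply: ler_sum => p p_pr; rewrite ler_wpM2l ?ell_ge0 ?prime_gt0 //.
  by rewrite [leRHS](@big_cat_nat _ _ _ y.+1) //= lerDl sumr_ge0 // => k _; apply: Fp.
rewrite lerDl sumr_ge0 // => p p_pr; rewrite mulr_ge0 ?ell_ge0 ?prime_gt0 //.
by rewrite sumr_ge0 // => k _; apply: Fp.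
Qed.

Lemma sum_pfactor_dvd p n y : prime p -> (0 < n <= y)%N ->
  \sum_(1 <= k < y.+1) ((p ^ k %| n)%N%:R : R) = (logn p n)%:R.
Proof.
move=> p_pr /andP[n0 ny].
have ly : (logn p n <= y)%N.
  by apply: leq_trans ny; apply/ltnW/ltn_logl.
rewrite (@big_cat_nat _ _ _ (logn p n).+1) //= [X in _ + X]big_nat_cond.
rewrite [X in _ + X]big1 => [|k /andP[/andP[lk _] _]]; last first.
  by rewrite pfactor_dvdn // leqNgt lk.
rewrite addr0 big_nat (eq_bigr (fun=> 1)) => [|k /andP[_ kl]]; last first.
  by rewrite pfactor_dvdn // -ltnS kl.
by rewrite -big_nat sumr_const_nat subn1.
Qed.

(** The identity log = Lambda * 1, proved by removing one prime factor at a time. *)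
Lemma ell_mangoldt n y : (0 < n <= y)%N ->
  ell n = mangoldt_sum y (fun m => (m %| n)%N%:R).
Proof.
move=> ny; have [n0 le_ny] := andP ny.
have -> : mangoldt_sum y (fun m => (m %| n)%N%:R) =
    \sum_(1 <= p < y.+1 | prime p) ell p * (logn p n)%:R.
  by apply: eq_bigr => p p_pr; rewrite sum_pfactor_dvd.
elim/ltn_ind: n n0 le_ny {ny} => n IH n0 ny; have [n1|n1] := leqP n 1.
  have -> : n = 1%N by apply/eqP; rewrite eqn_leq n1.
  by rewrite ell1 big1 // => p _; rewrite logn1 mulr0.
have q_pr := pdiv_prime n1; set q := pdiv n in q_pr.
have nE : n = (q * (n %/ q))%N by rewrite mulnC divnK // pdiv_dvd.
have m0 : (0 < n %/ q)%N by rewrite divn_gt0 ?prime_gt0 // dvdn_leq // pdiv_dvd.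
have mn : (n %/ q < n)%N by rewrite ltn_Pdiv // prime_gt1.
have qy : (q <= y)%N by apply: leq_trans ny; rewrite dvdn_leq // pdiv_dvd.
rewrite {1}nE (ellM (prime_gt0 q_pr) m0) (IH _ mn m0 (leq_trans (ltnW mn) ny)).
rewrite [in RHS](eq_bigr (fun p => ell p * (p == q)%:R + ell p * (logn p (n %/ q))%:R)).
  rewrite big_split /=; congr (_ + _).
  rewrite big_mkcond (bigD1_seq q) ?iota_uniq //=; last first.
    by rewrite mem_index_iota prime_gt0.
  rewrite q_pr eqxx mulr1 big1 ?addr0 // => p /negbTE ->.
  by rewrite mulr0 if_same.
move=> p p_pr; rewrite {1}nE (lognM p (prime_gt0 q_pr) m0) logn_prime // natrD mulrDr.
by rewrite eq_sym.
Qed.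

Lemma sum_ell (f : nat -> R) x y : (x <= y)%N ->
  \sum_(1 <= n < x.+1) f n * ell n =
  mangoldt_sum y (fun m => \sum_(1 <= n < x.+1 | (m %| n)%N) f n).
Proof.
move=> xy; rewrite (mangoldt_sum_nat y 1 x.+1 (fun _ n => f n) (fun m n => (m %| n)%N)).
rewrite big_nat [RHS]big_nat; apply: eq_bigr => n /andP[n0 nx].
rewrite (@ell_mangoldt n y) ?n0 ?(leq_trans _ xy) // -mangoldt_sumZ.
by apply: eq_mangoldt_sum => m _; case: (m %| n)%N; rewrite ?mulr1 ?mulr0.
Qed.

Definition sum_ell_upto x : R := \sum_(1 <= n < x.+1) ell n.

Lemma sum_ell_upto_mangoldt x y : (x <= y)%N ->
  sum_ell_upto x = mangoldt_sum y (fun m => (x %/ m)%:R).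
Proof.
move=> xy; rewrite /sum_ell_upto.
rewrite (eq_bigr (fun n => 1 * ell n)) => [|n _]; last by rewrite mul1r.
rewrite (sum_ell (fun=> 1) xy); apply: eq_mangoldt_sum => m m0.
by rewrite (sum_multiples (fun=> 1)) ?(ltnW m0) // sumr_const_nat subn1.
Qed.

Lemma sum_ell_upto_fact x : sum_ell_upto x = ell x`!.
Proof.
rewrite /sum_ell_upto; elim: x => [|x IH]; first by rewrite big_geq // ell1.
by rewrite big_nat_recr //= IH factS ellM ?fact_gt0 // addrC.
Qed.

Lemma sum_ell_upto_ge x : x%:R * (ell x - 1) <= sum_ell_upto x.
Proof.
case: x => [|x]; first by rewrite mul0r /sum_ell_upto big_geq.
elim: x => [|x IH].
  by rewrite /sum_ell_upto big_nat1 ell1; lra.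
rewrite /sum_ell_upto big_nat_recr //= -/(sum_ell_upto x.+1).
have /andP[_ H] := @ell_incr x.+1 isT.
have x0 : 0 < x.+1%:R :> R by rewrite ltr0n.
have := ler_wpM2l (ltW x0) H; rewrite mulfV ?gt_eqF // => {}H.
rewrite -[x.+2%:R]natr1; move: (x.+1%:R : R) x0 H IH => a a0 H IH; lra.
Qed.

(** Chebyshev's psi. The indicator does the truncation, since the box of [mangoldt_sum] contains
    prime powers far beyond [x]; its size [y] is kept free so that values at x and 2x can be
    compared in one box. *)
Definition cheb y x : R := mangoldt_sum y (fun m => (m <= x)%N%:R).

Lemma central_bin_ub n : ('C(n.*2, n) <= 2 ^ n.*2)%N.
Proof.
have := expnDn 1 1 n.*2; rewrite addn1 => ->.
have nn : (n < n.*2.+1)%N by rewrite ltnS -addnn leq_addr.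
by rewrite (bigD1 (Ordinal nn)) //= !exp1n !muln1 leq_addr.
Qed.

(** The logarithm of the central binomial coefficient is the sum of Lambda(m) (floor(2x/m) - 2
    floor(x/m)). The bracket is never negative and equals 1 for x < m <= 2x. *)
Lemma cheb_double y x : (x.*2 <= y)%N ->
  cheb y x.*2 <= cheb y x + x.*2%:R * ell 2.
Proof.
move=> xy; have xy1 : (x <= y)%N by apply: leq_trans xy; rewrite -addnn leq_addr.
have : sum_ell_upto x.*2 - 2%:R * sum_ell_upto x <= x.*2%:R * ell 2.
  rewrite !sum_ell_upto_fact -(ellX x.*2) //.
  have nn : (x <= x.*2)%N by rewrite -addnn leq_addr.
  have := bin_fact nn; rewrite -addnn addnK addnn => <-.
  rewrite !ellM ?bin_gt0 ?muln_gt0 ?fact_gt0 //.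
  have : ell 'C(x.*2, x) <= ell (2 ^ x.*2) by rewrite ell_mono // bin_gt0 nn central_bin_ub.
  lra.
rewrite (sum_ell_upto_mangoldt xy) (sum_ell_upto_mangoldt xy1) => H.
rewrite -lerBlDl; apply: le_trans H.
rewrite lerBrDr /cheb -mangoldt_sumZ addrAC -mangoldt_sumD lerBlDr -mangoldt_sumD.
apply: ler_mangoldt_sum => m m0; rewrite -natrM -!natrD ler_nat.
have le2 : (2 * (x %/ m) <= x.*2 %/ m)%N.
  by rewrite leq_divRL // -mulnA -muln2 mulnC leq_mul2r leq_divM.
have [mx|xm] := leqP m x; first by move: le2; case: (m <= x.*2)%N; lia.
rewrite divn_small //; case: (leqP m x.*2) => // mx.
have : (0 < x.*2 %/ m)%N by rewrite divn_gt0.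
lia.
Qed.

(** The constant 4 absorbs the rounding in the halving step: 4 h + 2 h <= 4 x for h = ceil(x/2) and
    x >= 2. *)
Lemma cheb_ub y x : (x.*2 <= y)%N -> cheb y x <= 4%:R * ell 2 * x%:R.
Proof.
elim/ltn_ind: x => x IH xy; have [x1|x1] := leqP x 1.
  rewrite /cheb (@eq_mangoldt_sum _ _ (fun=> 0 * 0)) => [|m m1].
    by rewrite mangoldt_sumZ mul0r !mulr_ge0 // ltW.
  by rewrite leqNgt (leq_ltn_trans x1 m1) mul0r.
pose h := uphalf x.
have hx : (h < x)%N by rewrite /h; lia.
have h2 : (x <= h.*2 <= x.+1)%N by rewrite /h; lia.
have : cheb y x <= cheb y h.*2.
  apply: ler_mangoldt_sum => m _; rewrite ler_nat; have [xh _] := andP h2.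
  by have [mx|//] := leqP m x; rewrite (leq_trans mx xh).
move/le_trans; apply.
have hy : (h.*2 <= y)%N by move: xy h2 x1; lia.
apply: le_trans (cheb_double hy) _; apply: le_trans (lerD (IH h hx hy) (lexx _)) _.
have -> : 4%:R * ell 2 * h%:R + h.*2%:R * ell 2 = ell 2 * (6 * h)%:R.
  by rewrite -muln2 !natrM; ring.
have -> : 4%:R * ell 2 * x%:R = ell 2 * (4 * x)%:R by rewrite natrM; ring.
by rewrite ler_pM2l // ler_nat; lia.
Qed.

Lemma cheb_diag_ub x : cheb x x <= 4%:R * ell 2 * x%:R.
Proof.
apply: le_trans (cheb_ub (leqnn x.*2)).
by apply: mangoldt_sum_widen => //; rewrite -addnn leq_addr.
Qed.

(** From log x! = sum of Lambda(m) floor(x/m), with floor(x/m) <= x/m and log x! >= x (log x -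
    1). *)
Lemma mangoldt_sum_inv_ge x : (0 < x)%N ->
  ell x - 1 <= mangoldt_sum x (fun m => (m <= x)%N%:R / m%:R).
Proof.
move=> x0; have xp : 0 < x%:R :> R by rewrite ltr0n.
rewrite -(ler_pM2l xp); apply: le_trans (sum_ell_upto_ge x) _.
rewrite (sum_ell_upto_mangoldt (leqnn x)) -mangoldt_sumZ.
apply: ler_mangoldt_sum => // m m0; have [mx|xm] := leqP m x.
  by rewrite mul1r ler_pdivlMr ?ltr0n // -natrM ler_nat leq_divM.
by rewrite divn_small // mul0r mulr0.
Qed.

Lemma abel_log_bound (chi : nat -> R) (C : R) :
  (forall a b, `|\sum_(a <= i < b) chi i| <= C) ->
  exists A, forall x, `|\sum_(1 <= n < x.+1) chi n / n%:R * ell n| <= A.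
Proof.
(* log n / n is decreasing once log n >= 1; the finitely many terms before [n0] go into [H]. *)
move=> chiC; have [n0 [n00 en0]] := ell_unbounded 1.
pose w n := ell n / n%:R.
pose H := \sum_(1 <= n < n0) `|chi n / n%:R * ell n|.
have C0 := chi_bound_ge0 chiC.
have w0 i : (n0 <= i)%N -> 0 <= w i.
  move=> ni; rewrite /w divr_ge0 ?ler0n //.
  by apply: ell_ge0 _ _; apply: leq_trans ni.
exists (H + C * w n0) => x.
have Cw : 0 <= C * w n0 by rewrite mulr_ge0 // w0.
have [xn|nx] := leqP x.+1 n0.
  apply: le_trans (ler_norm_sum _ _ _) _; apply: ler_wpDr => //.
  by rewrite /H (@big_cat_nat _ _ _ x.+1 1 n0) //= lerDl sumr_ge0.
rewrite (@big_cat_nat _ _ _ n0) //=; last exact: ltnW.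
apply: le_trans (ler_normD _ _) _; apply: lerD; first exact: ler_norm_sum.
rewrite (eq_bigr (fun n => chi n * w n)) => [|n _]; last by rewrite /w; ring.
apply: abel_bound => // i ni.
have i0 : (0 < i)%N by apply: leq_trans ni.
have ip : 0 < i%:R :> R by rewrite ltr0n.
rewrite /w ler_pdivrMr ?ltr0n // mulrAC ler_pdivlMr // -natr1.
have /andP[_ Hi] := ell_incr i0.
have := ler_wpM2l (ltW ip) Hi; rewrite mulfV ?gt_eqF // => {}Hi.
have ei : 1 <= ell i.
  by apply: ltW; apply: lt_le_trans en0 _; apply: ell_mono; rewrite n00.
move: Hi ei; move: (i%:R : R) (ell i) (ell i.+1) => a b c; lra.
Qed.

(** The bounded sum of chi(n) log n / n equals the sum of Lambda(m) chi(m)/m times [Lsum (x %/ m)].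
    Replacing [Lsum (x %/ m)] by [Lsum x] costs at most C m/x per term, in total C psi(x)/x, which
    Chebyshev bounds; then [Lsum x], being away from 0, can be divided out. *)
Lemma chi_mangoldt_bounded (chi : nat -> R) (C : R) :
  chi 1 = 1 -> (forall m n, chi (m * n)%N = chi m * chi n) ->
  (forall n, [\/ chi n = 0, chi n = 1 | chi n = -1]) ->
  (forall a b, `|\sum_(a <= i < b) chi i| <= C) ->
  exists D N1, forall x, (N1 <= x)%N ->
    `|mangoldt_sum x (fun m => (m <= x)%N%:R * (chi m / m%:R))| <= D.
Proof.
move=> chi1 chiM chi_val chiC.
have [A HA] := abel_log_bound chiC.
have [d [N1 [d0 Hd]]] := Lsum_away chi1 chiM chi_val chiC.
have C0 := chi_bound_ge0 chiC.
exists ((A + C * (4%:R * ell 2)) / d), N1.+1 => x N1x.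
have x0 : (0 < x)%N by apply: leq_trans N1x.
have xp : 0 < x%:R :> R by rewrite ltr0n.
set P := mangoldt_sum _ _.
rewrite ler_pdivlMr //; apply: (@le_trans _ _ (`|P| * `|Lsum chi x|)).
  by rewrite ler_wpM2l // Hd // ltnW.
rewrite -normrM.
have SE : \sum_(1 <= n < x.+1) chi n / n%:R * ell n =
    mangoldt_sum x (fun m => chi m / m%:R * Lsum chi (x %/ m)).
  rewrite (sum_ell (fun n => chi n / n%:R) (leqnn x)).
  apply: eq_mangoldt_sum => m m1; rewrite sum_multiples ?(ltnW m1) //.
  rewrite /Lsum mulr_sumr; apply: eq_bigr => k _.
  by rewrite chiM natrM invfM mulrACA.
have -> : P * Lsum chi x = \sum_(1 <= n < x.+1) chi n / n%:R * ell n -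
    mangoldt_sum x (fun m => chi m / m%:R * (Lsum chi (x %/ m) - (m <= x)%N%:R * Lsum chi x)).
  rewrite SE mulrC /P -mangoldt_sumZ -mulN1r -mangoldt_sumZ -mangoldt_sumD.
  by apply: eq_mangoldt_sum => m _; ring.
apply: le_trans (ler_normB _ _) _; apply: lerD (HA x) _.
apply: le_trans (ler_norm_mangoldt_sum _ _) _.
apply: (@le_trans _ _ (mangoldt_sum x (fun m => C / x%:R * (m <= x)%N%:R))); last first.
  rewrite mangoldt_sumZ -mulrA ler_wpM2l // mulrC ler_pdivrMr //.
  exact: cheb_diag_ub.
apply: ler_mangoldt_sum => // m m0; have mp : 0 < m%:R :> R by rewrite ltr0n.
have [mx|xm] := leqP m x; last first.
  by rewrite divn_small // mul0r subr0 /Lsum big_geq // mulr0 normr0 mulr0.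
rewrite mul1r mulr1 !normrM normfV (ger0_norm (ltW mp)).
have D : `|Lsum chi (x %/ m) - Lsum chi x| <= C / (x %/ m).+1%:R.
  by rewrite distrC; apply: Lsum_diff chiC _ _ _; apply: leq_div.
have D2 : C / (x %/ m).+1%:R <= C * (m%:R / x%:R).
  rewrite ler_wpM2l // -[leRHS]invrK invf_div lef_pV2 ?posrE ?divr_gt0 ?ltr0n //.
  by rewrite ler_pdivrMr // -natrM ler_nat ltnW // ltn_ceil.
have c1 := chi_le1 chi_val m.
have -> : C / x%:R = 1 * m%:R^-1 * (C * (m%:R / x%:R)).
  by field; rewrite !gt_eqF.
apply: ler_pM => //; last exact: le_trans D D2.
  by rewrite mulr_ge0 // invr_ge0 ltW.
by rewrite ler_wpM2r // invr_ge0 ltW.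
Qed.
End Mertens.

Lemma periodic_sum_bound (R : realFieldType) (chi : nat -> R) M : (0 < M)%N ->
  (forall n, chi n = chi (n %% M)%N) -> (forall n, `|chi n| <= 1) ->
  \sum_(0 <= i < M) chi i = 0 ->
  forall a b, `|\sum_(a <= i < b) chi i| <= (2 * M)%N%:R.
Proof.
move=> M0 chi_per chi1 sum0.
have S k : `|\sum_(0 <= i < k) chi i| <= M%:R.
  elim/ltn_ind: k => k IH; have [kM|Mk] := leqP k M.
    apply: le_trans (ler_norm_sum _ _ _) _.
    apply: (@le_trans _ _ (\sum_(0 <= i < k) 1)); first by apply: ler_sum.
    by rewrite sumr_const_nat subn0 ler_nat.
  rewrite (@big_cat_nat _ _ _ M) //=; last exact: ltnW.
  rewrite sum0 add0r -{1}[M]add0n big_addn.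
  rewrite (eq_bigr chi) => [|i _]; last by rewrite chi_per modnDr -chi_per.
  by apply: IH; rewrite -subn_gt0 subKn // ltnW.
move=> a b; have [ba|ab] := leqP b a; first by rewrite big_geq // normr0.
have -> : \sum_(a <= i < b) chi i = \sum_(0 <= i < b) chi i - \sum_(0 <= i < a) chi i.
  by rewrite (@big_cat_nat _ _ _ a 0 b) //= ?(ltnW ab) // addrAC subrr add0r.
by apply: le_trans (ler_normB _ _) _; rewrite mul2n -addnn natrD lerD.
Qed.

(** * From Mertens' estimates to a prime, by orthogonality of characters *)

Section PrimePattern.
Variables (R : archiRealFieldType) (ell : nat -> R).
Hypothesis ellM : forall m n, (0 < m)%N -> (0 < n)%N -> ell (m * n) = ell m + ell n.
Hypothesis ell_incr : forall n, (0 < n)%N -> 0 <= ell n.+1 - ell n <= n%:R^-1.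
Hypothesis ell2 : 0 < ell 2.
Local Notation mangoldt_sum := (mangoldt_sum ell).

Variables (I : finType) (M : nat) (e : I -> nat -> bool).
Hypothesis M0 : (0 < M)%N.
Hypothesis eM : forall i m n, coprime m M -> coprime n M ->
  e i (m * n) = e i m (+) e i n.
Hypothesis e_mod : forall i n, e i n = e i (n %% M).
Hypothesis e_indep : forall i, exists b, coprime b M /\ forall j, e j b = (j == i).

(** The empty set gives the principal character; [e_indep] makes all the others nonprincipal. *)
Definition set_char (S : {set I}) n : R :=
  (coprime n M)%:R * (-1) ^+ (\big[addb/false]_(i in S) e i n).

Lemma set_char1 S : set_char S 1 = 1.
Proof.
rewrite /set_char coprime1n mul1r big1 // => i _.
by have := @eM i 1 1 (coprime1n _) (coprime1n _); rewrite muln1; case: e.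
Qed.

Lemma set_charM S m n : set_char S (m * n) = set_char S m * set_char S n.
Proof.
rewrite /set_char coprimeMl; have [cm|] := boolP (coprime m M); last by rewrite !mul0r.
have [cn|] := boolP (coprime n M); last by rewrite !mul0r mulr0.
rewrite !mul1r -signr_addb -big_split /=; congr (_ ^+ nat_of_bool _).
by apply: eq_bigr => i _; rewrite eM.
Qed.

Lemma set_char_val S n : [\/ set_char S n = 0, set_char S n = 1 | set_char S n = -1].
Proof.
rewrite /set_char; case: coprime; rewrite ?mul0r ?mul1r; last exact: Or31.
by case: (\big[_/_]_(_ in _) _); rewrite ?expr1; [apply: Or33 | apply: Or32].
Qed.

Lemma set_char_mod S n : set_char S n = set_char S (n %% M).
Proof.
rewrite /set_char coprime_modl; congr (_ * (-1) ^+ nat_of_bool _).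
by apply: eq_bigr => i _; rewrite e_mod.
Qed.

(** Multiplication by a unit b of character -1 permutes the residues and changes the sign of the
    sum. *)
Lemma set_char_sum0 S : S != set0 -> \sum_(0 <= i < M) set_char S i = 0.
Proof.
case/set0Pn=> i iS; have [b [cb eb]] := e_indep i.
have chib : set_char S b = -1.
  rewrite /set_char cb mul1r (bigD1 i) //= eb eqxx big1 ?addbF ?expr1 //.
  by move=> j /andP[_ /negbTE ji]; rewrite eb ji.
pose h (j : 'I_M) := Ordinal (ltn_pmod (b * j) M0).
have h_inj : injective h.
  move=> j k /(congr1 val) /= E; apply: val_inj => /=.
  wlog jk : j k E / (j <= k)%N.
    by move=> W; have [jk|/ltnW kj] := leqP j k; [apply: W | apply/esym/W].
  have : (M %| b * k - b * j)%N by rewrite -eqn_mod_dvd ?E // leq_mul2l jk orbT.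
  rewrite -mulnBr Gauss_dvdr 1?coprime_sym // => Mkj; apply/eqP; rewrite eqn_leq jk /=.
  rewrite leqNgt; apply/negP => jk'.
  have := dvdn_leq _ Mkj; rewrite subn_gt0 => /(_ jk').
  by rewrite leqNgt (leq_ltn_trans (leq_subr _ _)).
rewrite big_mkord; set T := \sum_(_ < _) _.
have : T = - T.
  rewrite {1}/T (reindex_inj h_inj) /T -sumrN; apply: eq_bigr => j _.
  by rewrite /= -set_char_mod set_charM chib mulN1r.
by move=> E; lra.
Qed.

Lemma set_char_sum_bound S : S != set0 ->
  forall a b, `|\sum_(a <= i < b) set_char S i| <= (2 * M)%N%:R.
Proof.
move=> S0; apply: periodic_sum_bound => //; first exact: set_char_mod.
  exact: (chi_le1 (set_char_val S)).
exact: set_char_sum0.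
Qed.

Lemma sum_inv_pow (p x : nat) : (1 < p)%N ->
  \sum_(1 <= k < x.+1) ((p ^ k)%N%:R : R)^-1 <= 1.
Proof.
move=> p1; have p0 : (0 < p)%N by apply: ltnW.
have pp : 0 < p%:R :> R by rewrite ltr0n.
suff : \sum_(1 <= k < x.+1) ((p ^ k)%N%:R : R)^-1 <= 1 - ((p ^ x)%N%:R : R)^-1.
  by move/le_trans; apply; rewrite gerBl invr_ge0.
elim: x => [|x IH]; first by rewrite big_geq // invr1 subrr.
rewrite big_nat_recr //= expnS natrM invfM.
have q0 : 0 < ((p ^ x)%N%:R : R)^-1 by rewrite invr_gt0 ltr0n expn_gt0 p0.
have p2 : p%:R^-1 <= 2%:R^-1 :> R by rewrite lef_pV2 ?posrE // ler_nat.
have := ler_wpM2r (ltW q0) p2; move: IH; lra.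
Qed.

(** Each prime divisor p of M contributes log p times a geometric series of sum at most 1, whatever
    [x] is. *)
Lemma mangoldt_noncoprime_ub x :
  mangoldt_sum x (fun m => (m <= x)%N%:R * ((~~ coprime m M)%:R / m%:R)) <=
  \sum_(1 <= p < M.+1) ell p.
Proof.
have l0 p : (0 < p)%N -> 0 <= ell p by exact: ell_ge0 ellM ell_incr _.
apply: (@le_trans _ _ (\sum_(1 <= p < x.+1) if (p < M.+1)%N then ell p else 0)).
  rewrite /mangoldt_sum big_mkcond big_nat [leRHS]big_nat.
  apply: ler_sum => p /andP[p0 _]; case: ifP => [p_pr|_]; last first.
    by case: ifP => // _; apply: l0.
  have [pM|pM] := boolP (p %| M)%N.
    rewrite ltnS (dvdn_leq M0 pM) -[leRHS]mulr1 ler_wpM2l ?l0 //.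
    apply: le_trans (sum_inv_pow x (prime_gt1 p_pr)); apply: ler_sum => k _.
    by case: (_ <= x)%N; case: coprime; rewrite ?mul0r ?mul1r ?mul0r ?invr_ge0 ?ler0n.
  rewrite big1 => [|k _]; first by rewrite mulr0; case: ifP => // _; apply: l0.
  by rewrite coprimeXl ?prime_coprime // mul0r mulr0.
apply: (@le_trans _ _ (\sum_(1 <= p < (x + M).+1) if (p < M.+1)%N then ell p else 0)).
  rewrite [leRHS](@big_cat_nat _ _ _ x.+1) //= ?ltnS ?leq_addr // lerDl.
  rewrite big_nat sumr_ge0 // => p /andP[xp _]; case: ifP => // _; apply: l0.
  exact: leq_trans xp.
by rewrite -big_mkcond (@big_nat_widen _ _ _ 1 M.+1 (x + M).+1) // ltnS leq_addl.
Qed.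

(* The sum runs over prime powers, and s i0 rules out the even ones, at which all
   characters are trivial. *)
Theorem exists_prime_pattern (s : I -> bool) i0 : s i0 ->
  exists q, [/\ prime q, coprime q M & forall i, e i q = s i].
Proof.
move=> si0; pose T S x := mangoldt_sum x (fun m => (m <= x)%N%:R * (set_char S m / m%:R)).
have [DN HDN] : exists DN : {set I} -> R * nat, forall S, S != set0 ->
    forall x, ((DN S).2 <= x)%N -> `|T S x| <= (DN S).1.
  apply: (fin_all_exists (P := fun S (DN : R * nat) => S != set0 ->
    forall x, (DN.2 <= x)%N -> `|T S x| <= DN.1)) => S.
  have [->|S0] := eqVneq S set0; first by exists (0, 0%N) => /eqP.
  have [D [N H]] := chi_mangoldt_bounded ellM ell_incr ell2 (set_char1 S)
    (set_charM S) (set_char_val S) (set_char_sum_bound S0).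
  by exists (D, N).
pose K := \sum_(1 <= p < M.+1) ell p.
(* The principal character contributes at least log x - 1 - K; past [x0] this exceeds the bounds for
   all other characters together. *)
have [x0 [x00 Hx0]] := ell_unbounded ellM ell2 (1 + K + \sum_(S | S != set0) (DN S).1).
pose x := (x0 + \sum_S (DN S).2)%N.
have x_ge S : ((DN S).2 <= x)%N.
  by rewrite /x (bigD1 S) //= addnCA leq_addr.
have ellx : 1 + K + \sum_(S | S != set0) (DN S).1 < ell x.
  by apply: lt_le_trans Hx0 _; apply: (ell_mono ell_incr); rewrite x00 leq_addr.
have x_gt0 : (0 < x)%N by rewrite addn_gt0 x00.
have T0 : ell x - 1 - K <= T set0 x.
  have := mangoldt_noncoprime_ub x; have := mangoldt_sum_inv_ge ellM ell_incr x_gt0.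
  suff -> : mangoldt_sum x (fun m => (m <= x)%N%:R / m%:R) = T set0 x +
      mangoldt_sum x (fun m => (m <= x)%N%:R * ((~~ coprime m M)%:R / m%:R)).
    by rewrite -/K => H1 H2; lra.
  rewrite -mangoldt_sumD; apply: eq_mangoldt_sum => m _.
  by rewrite /set_char big_set0 expr0 mulr1; case: coprime; rewrite /= ?mul0r ?mulr0 ?addr0 ?add0r !mul1r.
have [/existsP[q /and3P[q_pr cq /forallP eq_s]]|/existsPn no_q] := boolP
  [exists q : 'I_x.+1, [&& prime q, coprime q M & [forall i, e i q == s i]]].
  by exists q; split=> // i; apply/eqP.
exfalso.
(* [F] is 2^#|I| times the indicator of the pattern among integers coprime to M, and the [c S] are
   its coefficients on the characters. Without a suitable prime, [F] vanishes on the whole box. *)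
pose c (S : {set I}) : R := \prod_(i in S) (-1) ^+ s i.
pose F m : R := (coprime m M)%:R * \prod_i (1 + (-1) ^+ s i * (-1) ^+ e i m).
have FE m : F m = \sum_S c S * set_char S m.
  rewrite /F (eq_bigr (fun i => (-1) ^+ s i * (-1) ^+ e i m + 1)) => [|i _]; last exact: addrC.
  rewrite bigA_distr mulr_sumr; apply: eq_bigr => S _.
  rewrite -big_mkcond big_split /= -/(c S) mulrCA; congr (_ * (_ * _)).
  by apply/esym/(big_morph (fun b : bool => (-1) ^+ b)) => // a b; rewrite signr_addb.
have eX i p k : coprime p M -> e i (p ^ k) = odd k && e i p.
  move=> cp; elim: k => [|k IH] /=.
    by have := @eM i 1 1 (coprime1n _) (coprime1n _); rewrite muln1; case: e.
  by rewrite expnS eM ?coprimeXl // IH; case: odd; case: e.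
have factor0 i p k : e i (p ^ k) != s i -> coprime p M -> F (p ^ k)%N = 0.
  move=> es cp; rewrite /F (bigD1 i) //=; suff -> : 1 + (-1) ^+ s i * (-1) ^+ e i (p ^ k) = 0 :> R.
    by rewrite mul0r mulr0.
  by move: es; rewrite -signr_addb; case: (e i _); case: (s i) => //= _; rewrite expr1 subrr.
have FX p k : prime p -> (p <= x)%N -> (0 < k)%N -> F (p ^ k)%N = 0.
  move=> p_pr px k0; have [cp|ncp] := boolP (coprime p M); last first.
    by rewrite /F coprime_pexpl // (negbTE ncp) mul0r.
  have [k_odd|k_even] := boolP (odd k); last first.
    by apply: (@factor0 i0) => //; rewrite eX // (negbTE k_even) si0.
  have px' : (p < x.+1)%N by [].
  have := no_q (Ordinal px'); rewrite /= p_pr cp /= => /forallPn[i es].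
  by apply: (@factor0 i) => //; rewrite eX // k_odd.
have sum0 : \sum_S c S * T S x = 0.
  transitivity (mangoldt_sum x (fun m => (m <= x)%N%:R * (F m / m%:R))).
    rewrite (eq_bigr (fun S => mangoldt_sum x
      (fun m => c S * ((m <= x)%N%:R * (set_char S m / m%:R))))) => [|S _]; last first.
      by rewrite mangoldt_sumZ.
    rewrite -mangoldt_sum_sum; apply: eq_mangoldt_sum => m _.
    rewrite FE mulr_suml mulr_sumr; apply: eq_bigr => S _.
    by rewrite mulrCA -[c S * set_char S m / _]mulrA.
  rewrite /mangoldt_sum big_nat_cond big1 // => p /andP[/andP[_ px] p_pr].
  rewrite big_nat big1 ?mulr0 // => k /andP[k0 _].
  by rewrite FX // mul0r mulr0.
have c1 S : `|c S| = 1.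
  by rewrite normr_prod big1 // => i _; rewrite normr_sign.
have := sum0; rewrite (bigD1 set0) //= {1}/c big_set0 mul1r => /eqP.
rewrite addr_eq0 => /eqP ET0.
have : \sum_(S | S != set0) c S * T S x >= - \sum_(S | S != set0) (DN S).1.
  rewrite -sumrN; apply: ler_sum => S S0; rewrite lerNl.
  apply: le_trans (ler_norm _) _; rewrite normrN normrM c1 mul1r.
  exact: HDN (x_ge S).
by move=> H; move: T0; rewrite ET0 => T0; lra.
Qed.
End PrimePattern.

Section LogarithmOfNaturals.
Variable R : realType.
Let lnn (n : nat) : R := exp.ln n%:R.

Lemma ln_natM m n : (0 < m)%N -> (0 < n)%N -> lnn (m * n) = lnn m + lnn n.
Proof. by move=> m0 n0; rewrite /lnn natrM exp.lnM // posrE ltr0n. Qed.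

Lemma ln_nat_incr n : (0 < n)%N -> 0 <= lnn n.+1 - lnn n <= n%:R^-1.
Proof.
move=> n0; have np : 0 < n%:R :> R by rewrite ltr0n.
apply/andP; split.
  by rewrite subr_ge0 exp.ler_ln ?posrE ?ltr0n // ler_nat.
rewrite -exp.ln_div ?posrE ?ltr0n // -natr1 mulrDl mulfV ?gt_eqF // mul1r.
by apply: exp.le_ln1Dx; apply: lt_trans (ltrN10 _) _; rewrite invr_gt0.
Qed.

Lemma ln_nat2 : 0 < lnn 2.
Proof. by rewrite /lnn exp.ln_gt0 // ltr1n. Qed.
End LogarithmOfNaturals.

(* The indices 0, 2 and p stand for the characters attached to -1, 2 and p. *)
Definition symbol_char (i n : nat) : bool :=
  if i == 0%N then (n %% 4 == 3)%N
  else if i == 2 then (n %% 8 == 3)%N || (n %% 8 == 5)%N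
  else qnr i n.

Lemma mod8_symbolsM m n : odd m -> odd n ->
  (m * n %% 4 == 3)%N = (m %% 4 == 3)%N (+) (n %% 4 == 3)%N /\
  ((m * n %% 8 == 3) || (m * n %% 8 == 5))%N =
  ((m %% 8 == 3) || (m %% 8 == 5))%N (+) ((n %% 8 == 3) || (n %% 8 == 5))%N.
Proof.
move=> om on; have m0 : m%:Z != 0 by case: m om.
have n0 : n%:Z != 0 by case: n on.
have := dclsM m0 n0; rewrite -PoszM !dcls_odd // ?oddM ?om //.
by rewrite /dadd /oadd /= => -[-> ->].
Qed.

Lemma symbol_char_odd p n : prime p -> odd p -> symbol_char p n = qnr p n.
Proof. by rewrite /symbol_char; case: p => [|[|[|p]]]. Qed.

Lemma symbol_indexP i : (i == 0%N) || prime i ->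
  [\/ i = 0%N, i = 2 | prime i /\ odd i].
Proof.
have [->|_] := eqVneq i 0%N; first by constructor.
move=> /= i_pr; have [i_odd|/(prime_oddPn i_pr)] := boolP (odd i).
  by constructor 3.
by constructor.
Qed.

(** * Independence of the characters attached to -1, 2 and the odd primes *)

Section SymbolChars.
Variables (l M : nat).
Hypothesis M0 : (0 < M)%N.
Hypothesis M8 : (8 %| M)%N.
Hypothesis Mp : forall p, prime p -> (p <= l)%N -> (p %| M)%N.

Lemma coprime_odd k : coprime k M -> odd k.
Proof.
by move=> ck; move: (coprime_dvdr M8 ck); rewrite (@coprime_pexpr 3 k 2) // coprimen2.
Qed.

Lemma coprime_ndvd p k : prime p -> (p <= l)%N -> coprime k M -> ~~ (p %| k%:Z)%Z.
Proof.
move=> p_pr pl ck; rewrite dvdzE /= -prime_coprime // coprime_sym.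
exact: coprime_dvdr (Mp p_pr pl) ck.
Qed.

Lemma symbol_charM i m n : (i == 0%N) || prime i -> (i <= l)%N ->
  coprime m M -> coprime n M ->
  symbol_char i (m * n) = symbol_char i m (+) symbol_char i n.
Proof.
move=> /symbol_indexP iP il cm cn.
have [E4 E8] := mod8_symbolsM (coprime_odd cm) (coprime_odd cn).
case: iP il => [->|->|[i_pr i_odd]] il //.
by rewrite !symbol_char_odd // PoszM qnrM // coprime_ndvd.
Qed.

Lemma symbol_char_congr i m n d : (i == 0%N) || prime i ->
  (i = 0%N \/ i = 2 -> (8 %| d)%N) -> (odd i -> (i %| d)%N) -> m = n %[mod d] ->
  symbol_char i m = symbol_char i n.
Proof.
move=> /symbol_indexP iP id8 idp mn.
have congr k : (k %| d)%N -> (m %% k = n %% k)%N.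
  by move=> kd; rewrite -(modn_dvdm m kd) mn modn_dvdm.
case: iP id8 idp => [->|->|[i_pr i_odd]] id8 idp.
- by rewrite /symbol_char /= congr // (dvdn_trans _ (id8 (or_introl erefl))).
- by rewrite /symbol_char /= congr // (id8 (or_intror erefl)).
rewrite !symbol_char_odd //; apply: eq_qnr => //.
by rewrite -eqz_mod_dvd !modz_nat congr // idp.
Qed.

Lemma symbol_char1 i : (i == 0%N) || prime i -> symbol_char i 1 = false.
Proof.
move=> /symbol_indexP [->|->|[i_pr i_odd]] //.
by rewrite symbol_char_odd // qnr1.
Qed.

(** The Chinese remainder theorem for M = r^k M': b follows g at r and is 1 elsewhere, so that only
    the characters at r can see it. *)
Lemma prime_part_congr r g : prime r -> coprime g r ->
  exists b, [/\ coprime b M,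
    forall d, (d %| M)%N -> coprime r d -> b = 1 %[mod d] &
    forall k, (r ^ k %| M)%N -> b = g %[mod r ^ k]].
Proof.
move=> r_pr cgr; have [M' cM' ME] := pfactor_coprime r_pr M0.
set k := logn r M in ME; have ck : coprime (r ^ k) M' by rewrite coprimeXl.
have b1 := chinese_modl ck g 1; have b2 := chinese_modr ck g 1.
set b := chinese _ _ _ _ in b1 b2; exists b; split.
- rewrite ME coprimeMr -coprime_modl b2 coprime_modl coprime1n /=.
  by rewrite -coprime_modl b1 coprime_modl coprimeXr.
- move=> d dM crd; have dM' : (d %| M')%N.
    by move: dM; rewrite ME Gauss_dvdl // coprimeXr // coprime_sym.
  by rewrite -(modn_dvdm _ dM') b2 modn_dvdm.
- move=> j; rewrite pfactor_dvdn // => jk.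
  have rjk : (r ^ j %| r ^ k)%N by rewrite dvdn_exp2l.
  by rewrite -(modn_dvdm _ rjk) b1 modn_dvdm.
Qed.

Lemma symbol_char_dual i : (i == 0%N) || prime i -> (i <= l)%N ->
  exists b, coprime b M /\ forall j, (j == 0%N) || prime j -> (j <= l)%N ->
    symbol_char j b = (j == i).
Proof.
move=> /symbol_indexP iP il.
have even_case g : coprime g 2 -> exists b, [/\ coprime b M,
    symbol_char 0 b = symbol_char 0 g, symbol_char 2 b = symbol_char 2 g &
    forall j, prime j -> odd j -> (j <= l)%N -> symbol_char j b = false].
  move=> cg; have [b [cb b1 b2]] := prime_part_congr (isT : prime 2) cg.
  have b8 := b2 3 M8; exists b; split=> //.
  - by apply: symbol_char_congr b8.
  - by apply: symbol_char_congr b8.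
  move=> j j_pr j_odd jl; rewrite -(@symbol_char1 j) ?j_pr ?orbT //.
  apply: (@symbol_char_congr _ _ _ j); rewrite ?j_pr ?orbT //.
    by case=> [j0|j2]; [move: j_pr; rewrite j0 | move: j_odd; rewrite j2].
  by apply: b1; rewrite ?Mp // coprime2n.
case: iP il => [->|->|[i_pr i_odd]] il.
(* 7 is 3 modulo 4 but neither 3 nor 5 modulo 8; for 5, used next, it is the other way round. *)
- have [b [cb b0 b2 bp]] := even_case 7 isT; exists b; split=> // j.
  move=> /symbol_indexP[->|->|[j_pr j_odd]] jl //.
  by rewrite bp //; case: j j_pr {j_odd jl}.
- have [b [cb b0 b2 bp]] := even_case 5 isT; exists b; split=> // j.
  move=> /symbol_indexP[->|->|[j_pr j_odd]] jl //.
  by rewrite bp //; case: eqP j_odd => // ->.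
have [g [gi gq]] := exists_qnr i_pr i_odd.
have cgi : coprime g i by rewrite coprime_sym prime_coprime.
have [b [cb b1 b2]] := prime_part_congr i_pr cgi.
have b8 : b = 1 %[mod 8].
  by apply: b1 => //; rewrite (@coprime_pexpr 3 i 2) // coprimen2.
exists b; split=> // j jP jl; have [->|ji] := eqVneq j i.
  have := b2 1; rewrite expn1 => /(_ (Mp i_pr il)) bg.
  rewrite -gq -symbol_char_odd //; apply: symbol_char_congr bg => //.
    by rewrite i_pr orbT.
  by case=> [i0|i2]; [move: i_pr; rewrite i0 | move: i_odd; rewrite i2].
rewrite -(symbol_char1 jP); case/symbol_indexP: (jP) => [j0|j2|[j_pr j_odd]].
- by apply: symbol_char_congr b8; rewrite ?j0.
- by apply: symbol_char_congr b8; rewrite ?j2.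
apply: (@symbol_char_congr _ _ _ j) => //.
  by case=> [j0|j2]; [move: j_pr; rewrite j0 | move: j_odd; rewrite j2].
by apply: b1; rewrite ?Mp // prime_coprime // dvdn_prime2 // eq_sym.
Qed.

End SymbolChars.

Lemma prime_with_symbols B (s0 s2 : bool) (s : nat -> bool) :
  exists q, [/\ prime q, (B < q)%N, (q %% 4 == 3)%N = s0,
    (q %% 8 == 3)%N || (q %% 8 == 5)%N = s2 &
    forall p, prime p -> odd p -> (p <= B)%N -> qnr p q = s p].
Proof.
(* The pattern needs a nontrivial entry, whatever [s0], [s2] and [s] are; the auxiliary prime [l]
   above B supplies it. As all primes up to [l] divide M, coprimality to M also makes q larger than
   B. *)
have [l Bl l_pr] := prime_above B.+2.
have l2 : (2 < l)%N by apply: leq_trans Bl.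
pose I := {i : 'I_l.+1 | (val i == 0%N) || prime i}.
have [M [M0 M8 Mp]] : exists M, [/\ (0 < M)%N, (8 %| M)%N &
    forall p, prime p -> (p <= l)%N -> (p %| M)%N].
  exists (8 * l`!)%N; split; first by rewrite muln_gt0 fact_gt0.
    by rewrite dvdn_mulr.
  by move=> p p_pr pl; rewrite dvdn_mull // dvdn_fact // prime_gt0.
pose e (i : I) n := symbol_char (val (val i)) n.
have iP (i : I) : (val (val i) == 0%N) || prime (val (val i)) by apply: (valP i).
have il (i : I) : (val (val i) <= l)%N by rewrite -ltnS ltn_ord.
have eM i m n : coprime m M -> coprime n M -> e i (m * n) = e i m (+) e i n.
  exact: symbol_charM M8 Mp _ _ _ (iP i) (il i).
have e_mod i n : e i n = e i (n %% M)%N.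
  apply: (@symbol_char_congr _ _ _ M) => //; last by rewrite modn_mod.
  by move=> i_odd; case/symbol_indexP: (iP i) i_odd => [->|->|[i_pr _]] // _; apply: Mp.
have e_indep i : exists b, coprime b M /\ forall j, e j b = (j == i).
  have [b [cb eb]] := symbol_char_dual M0 M8 Mp (iP i) (il i).
  by exists b; split=> // j; rewrite /e eb // -!val_eqE.
have mkI i : (i == 0%N) || prime i -> (i <= l)%N -> {j : I | val (val j) = i}.
  rewrite -ltnS => i_P i_l.
  by exists (exist (fun i : 'I_l.+1 => (val i == 0%N) || prime i) (Ordinal i_l) i_P).
pose s' (i : I) := let j := val (val i) in
  if j == 0%N then s0 else if j == 2 then s2 else if (j <= B)%N then s j else true.
have lP : (l == 0%N) || prime l by rewrite l_pr orbT.
have [i0 i0l] := mkI l lP (leqnn l).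
have si0 : s' i0.
  by rewrite /s' i0l; case: eqP l2 => [->|] // _; case: eqP => [->|] // _ _;
    rewrite leqNgt (leq_trans _ Bl) // ltnW.
have [q [q_pr cq eq_s]] := exists_prime_pattern (@ln_natM Rdefinitions.R)
  (@ln_nat_incr _) (ln_nat2 _) M0 eM e_mod e_indep si0.
have Bl' : (B.+2 <= l)%N by apply: ltnW.
have symb i : (i == 0%N) || prime i -> (i <= l)%N -> exists j : I, val (val j) = i /\
    symbol_char i q = s' j.
  by move=> i_P i_l; have [j jE] := mkI i i_P i_l; exists j; rewrite -eq_s /e jE.
exists q; split=> //.
- rewrite ltnNge; apply/negP => qB.
  have /(Mp _ q_pr) qM : (q <= l)%N by apply: leq_trans qB _; apply: leq_trans Bl'; rewrite leqW.
  by move: cq; rewrite prime_coprime // qM.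
- by have [|j [jE]] := symb 0%N isT; rewrite // /s' jE.
- by have [|j [jE]] := symb 2 isT; rewrite ?(ltnW l2) // /s' jE.
move=> p p_pr p_odd pB.
have pl : (p <= l)%N by apply: leq_trans pB _; apply: leq_trans Bl'; rewrite leqW.
have [|j [jE]] := symb p _ pl; first by rewrite p_pr orbT.
rewrite symbol_char_odd // /s' jE pB => ->.
by case: p p_pr p_odd {pB pl jE} => [|[|[|p]]].
Qed.

(** * The local-global principle *)

Lemma exists_odd_valuations (v : nat -> bool) B : exists m : nat, (0 < m)%N /\
  forall p, prime p -> odd (logn p m) = v p && (p <= B)%N.
Proof.
elim: B => [|B [m [m0 IH]]].
  exists 1%N; split=> // p p_pr; rewrite logn1 leqn0.
  by case: p p_pr => // p _; rewrite andbF.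
have [/andP[B_pr vB]|nB] := boolP (prime B.+1 && v B.+1).
  exists (m * B.+1)%N; split=> [|p p_pr]; first by rewrite muln_gt0 m0.
  rewrite lognM // oddD IH // logn_prime // [(p <= B.+1)%N]leq_eqVlt ltnS.
  have [->|pB] := eqVneq p B.+1; first by rewrite vB ltnn ?eqxx.
  by rewrite ?(negbTE pB) addbF.
exists m; split=> // p p_pr; rewrite IH // [(p <= B.+1)%N]leq_eqVlt ltnS.
by have [pB|//] := eqVneq p B.+1; move: nB; rewrite -pB p_pr /= => /negbTE ->.
Qed.

Lemma hilb_last x y q : x != 0 -> y != 0 -> prime q -> odd q ->
  (forall p, prime p -> odd p -> p != q -> hilb p x y = false) ->
  hilb2 x y = false -> ~~ ((x < 0) && (y < 0)) -> hilb q x y = false.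
Proof.
move=> x0 y0 q_pr q_odd Hp H2 /negbTE Hinf.
have xB : (`|x| < (`|x| + `|y| + q).+1)%N by lia.
have yB : (`|y| < (`|x| + `|y| + q).+1)%N by lia.
have qB : (q < (`|x| + `|y| + q).+1)%N by lia.
have := hilb_product_formula x0 y0 xB yB.
by rewrite /hilb_total Hinf H2 (big_hilb_only qB q_pr q_odd Hp).
Qed.

(** Replaces a 2-adic analysis of solutions: once the symbols at the real place and at all odd
    primes vanish, nothing is left for 2. *)
Lemma hilb2_last x y : x != 0 -> y != 0 ->
  (forall p, prime p -> odd p -> hilb p x y = false) ->
  ~~ ((x < 0) && (y < 0)) -> hilb2 x y = false.
Proof.
move=> x0 y0 Hp /negbTE Hinf.
have xB : (`|x| < (`|x| + `|y|).+1)%N by lia.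
have yB : (`|y| < (`|x| + `|y|).+1)%N by lia.
have := hilb_product_formula x0 y0 xB yB.
by rewrite /hilb_total Hinf big1 ?addbF // => p /andP[p_pr p_odd]; apply: Hp.
Qed.

(** t is plus or minus m q: the sign and m settle the real place and the valuations, and q, a unit
    at 2 and at every p <= B, corrects the characters of the unit parts. *)
Lemma exists_with_classes B (ts : bool) (t2 : bool * (bool * bool))
    (tp : nat -> bool * bool) :
  exists (t : int) (q : nat), [/\ t != 0, (t < 0) = ts, dcls t = t2,
    [/\ prime q, odd q & (B < q)%N] &
    (forall p, prime p -> odd p -> (p <= B)%N -> ocls p t = tp p) /\
    (forall p, prime p -> odd p -> (B < p)%N -> p != q -> ~~ (ocls p t).1)].
Proof.
pose C := maxn B 2.
have [m [m0 mP]] := exists_odd_valuations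
  (fun p => if p == 2 then t2.1 else (tp p).1 && (p <= B)%N) C.
pose t0 : int := (-1) ^+ ts * m%:Z.
have t00 : t0 != 0 by rewrite mulf_neq0 ?signr_eq0 // -lt0n.
have t0_lt0 : (t0 < 0) = ts.
  by rewrite /t0; case: ts {t0 t00}; rewrite ?expr1 ?expr0 ?mul1r ?mulN1r ?oppr_lt0 ?ltz_nat.
have abst0 : `|t0|%N = m by rewrite abszM absz_sign mul1n.
have [q [q_pr Cq q4 q8 qp]] := prime_with_symbols C
  (t2.2.1 (+) (dcls t0).2.1) (t2.2.2 (+) (dcls t0).2.2)
  (fun p => (tp p).2 (+) (ocls p t0).2).
have q2 : (2 < q)%N by apply: leq_ltn_trans Cq; rewrite leq_maxr.
have q_odd : odd q by apply: contraTT q2 => /(prime_oddPn q_pr) ->.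
have Bq : (B < q)%N by apply: leq_ltn_trans Cq; rewrite leq_maxl.
have q0 : q%:Z != 0 by rewrite -lt0n prime_gt0.
exists (t0 * q%:Z), q; split=> //.
- by rewrite mulf_neq0.
- by rewrite pmulr_llt0 ?t0_lt0 // ltz_nat prime_gt0.
- rewrite dclsM // dcls_odd // q4 q8.
  have := mP 2 isT; rewrite /= leq_maxr andbT => v2.
  have d1 : (dcls t0).1 = t2.1 by rewrite /dcls abst0.
  rewrite /dadd /oadd d1 /= addbF.
  rewrite addbCA addbb addbF addbCA addbb addbF.
  by case: (t2) => ? [].
split=> p p_pr p_odd.
  move=> pB; have p2 : (p == 2) = false by case: eqP p_odd => // ->.
  have pC : (p <= C)%N by rewrite (leq_trans pB) // leq_maxl.
  have pq : (p == q) = false by apply: ltn_eqF; apply: leq_ltn_trans Bq.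
  rewrite oclsM // ocls_prime // pq qp //.
  have p1 : (ocls p t0).1 = (tp p).1 by rewrite /ocls abst0 mP // p2 pB pC !andbT.
  rewrite /oadd p1 /= addbF.
  by rewrite addbCA addbb addbF; case: (tp p).
move=> Bp pq; have p2 : (p == 2) = false by case: eqP p_odd => // ->.
rewrite oclsM // ocls_prime // (negbTE pq) /oadd /= addbF /ocls abst0 mP // p2.
by rewrite [(p <= B)%N]leqNgt Bp andbF.
Qed.

Lemma binary_isotropic_universal (F : numFieldType) (a b s t : F) : a != 0 -> s != 0 ->
  a * s ^+ 2 + b = 0 -> exists x y : F, a * x ^+ 2 + b * y ^+ 2 = t.
Proof.
move=> a0 s0 /eqP; rewrite addrC addr_eq0 => /eqP ->.
(* The form is a (x - s y)(x + s y); the witness solves x - s y = 1 and x + s y = t / a. *)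
exists ((1 + t / a) / 2%:R), ((t / a - 1) / (2%:R * s)).
field. by rewrite a0 s0.
Qed.

(** Multiplied by a, the equation reads (a x)^2 = a t - a b y^2, which is ternary after
    homogenization. A ternary solution with x = 0 cannot be dehomogenized, but it makes -ab a
    square, and the binary form is then isotropic. *)
Lemma binary_represents (a b t : int) : a != 0 -> b != 0 -> t != 0 ->
  (forall p, prime p -> odd p -> hilb p (a * t) (- (a * b)) = false) ->
  ~~ ((a * t < 0) && (- (a * b) < 0)) ->
  exists x y : rat, a%:~R * x ^+ 2 + b%:~R * y ^+ 2 = t%:~R.
Proof.
move=> a0 b0 t0 Hp Hinf.
have at0 : a * t != 0 by rewrite mulf_neq0.
have ab0 : - (a * b) != 0 by rewrite oppr_eq0 mulf_neq0.
have [x [y [z [nz E]]]] := ternary_Hasse at0 ab0 Hp Hinf.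
have a0' : a%:~R != 0 :> rat by rewrite intr_eq0.
have {}E : (z%:~R : rat) ^+ 2 = a%:~R * t%:~R * x%:~R ^+ 2 - a%:~R * b%:~R * y%:~R ^+ 2.
  by have := congr1 (intr : int -> rat) E; rewrite !(rmorphD, rmorphN, rmorphM, rmorphXn) /= mulNr.
have [x0|x0] := eqVneq x 0; last first.
  have x0' : x%:~R != 0 :> rat by rewrite intr_eq0.
  exists (z%:~R / (a%:~R * x%:~R)), (y%:~R / x%:~R).
  rewrite !expr_div_n E; field; by rewrite a0' x0'.
have y0 : y != 0.
  apply: contraTneq nz => y0; rewrite x0 y0 eqxx /=.
  by move: E; rewrite x0 y0 expr0n /= !mulr0 subrr => /eqP; rewrite sqrf_eq0 intr_eq0 negbK.
have z0 : z != 0.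
  apply/eqP => z0; move: E; rewrite z0 x0 expr0n /= mulr0 sub0r => /esym/eqP.
  by rewrite oppr_eq0 !mulf_eq0 /= !intr_eq0 (negbTE a0) (negbTE b0) (negbTE y0).
have y0' : y%:~R != 0 :> rat by rewrite intr_eq0.
have z0' : z%:~R != 0 :> rat by rewrite intr_eq0.
apply: (@binary_isotropic_universal _ _ _ (z%:~R / (a%:~R * y%:~R))) => //.
  by rewrite mulf_neq0 // invr_eq0 mulf_neq0.
rewrite expr_div_n E x0 expr0n /= mulr0 sub0r; field.
by rewrite a0' y0'.
Qed.

Lemma representedC (a b c : int) N : represented a b c N -> represented b a c N.
Proof. by case=> x [y [z E]]; exists y, x, z; rewrite -E; ring. Qed.

Lemma representedR (a b c : int) N : represented a b c N -> represented c a b N.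
Proof. by case=> x [y [z E]]; exists z, x, y; rewrite -E; ring. Qed.

Lemma isotropic_represented (a b c : int) (x y z N : rat) : a != 0 -> b != 0 -> c != 0 ->
  [|| x != 0, y != 0 | z != 0] ->
  a%:~R * x ^+ 2 + b%:~R * y ^+ 2 + c%:~R * z ^+ 2 = 0 -> represented a b c N.
Proof.
have W (a' b' c' : int) (x' y' z' : rat) : a' != 0 -> x' != 0 ->
    a'%:~R * x' ^+ 2 + b'%:~R * y' ^+ 2 + c'%:~R * z' ^+ 2 = 0 ->
    represented a' b' c' N.
  move=> a0 x0 E; have a0' : a'%:~R != 0 :> rat by rewrite intr_eq0.
  (* On the line through the first basis vector in the isotropic direction, the form is a + 2 a x l,
     linear in l. *)
  pose l : rat := (N - a'%:~R) / (2%:R * a'%:~R * x').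
  exists (l * x' + 1), (l * y'), (l * z').
  transitivity (l ^+ 2 * (a'%:~R * x' ^+ 2 + b'%:~R * y' ^+ 2 + c'%:~R * z' ^+ 2)
     + 2%:R * a'%:~R * x' * l + a'%:~R); first by ring.
  by rewrite E /l; field; rewrite a0' x0.
move=> a0 b0 c0 /or3P[x0|y0|z0] E.
- exact: W E.
- by apply: representedC; apply: (W b a c y x z) => //; rewrite -E; ring.
do 2!apply: representedR; apply: (W c a b z x y) => //.
by rewrite -E; ring.
Qed.

Lemma represented_of_split (a b c n t : int) (N m : rat) : a != 0 -> b != 0 -> c != 0 ->
  t != 0 -> N = n%:~R * m ^+ 2 ->
  (exists x y : rat, a%:~R * x ^+ 2 + b%:~R * y ^+ 2 = t%:~R) ->
  (exists z w : rat, (- c)%:~R * z ^+ 2 + n%:~R * w ^+ 2 = t%:~R) ->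
  represented a b c N.
Proof.
move=> a0 b0 c0 t0 NE [x [y E1]] [z [w E2]].
have t0' : t%:~R != 0 :> rat by rewrite intr_eq0.
have E : a%:~R * x ^+ 2 + b%:~R * y ^+ 2 + c%:~R * z ^+ 2 = n%:~R * w ^+ 2.
  by rewrite E1 -E2 rmorphN /=; ring.
have [w0|w0] := eqVneq w 0; last first.
  exists (x / w * m), (y / w * m), (z / w * m); rewrite NE.
  transitivity ((a%:~R * x ^+ 2 + b%:~R * y ^+ 2 + c%:~R * z ^+ 2) * (m ^+ 2 / w ^+ 2)).
    by field.
  by rewrite E; field.
apply: (@isotropic_represented _ _ _ x y z) => //; last by rewrite E w0 expr0n mulr0.
apply: contraNT t0'; rewrite !negb_or !negbK => /and3P[/eqP x0 /eqP y0 _].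
by rewrite -E1 x0 y0 expr0n !mulr0 addr0.
Qed.

Lemma hilb_solution_rat p (a b : int) (x y z : rat) : prime p -> odd p ->
  a != 0 -> b != 0 -> [|| x != 0, y != 0 | z != 0] ->
  z ^+ 2 = a%:~R * x ^+ 2 + b%:~R * y ^+ 2 -> hilb p a b = false.
Proof.
move=> p_pr p_odd a0 b0 nz E.
pose D := denq x * denq y * denq z.
have D0 : (D%:~R : rat) != 0 by rewrite intr_eq0 !mulf_neq0 ?denq_neq0.
have int_of (u : rat) (k : int) : u * (denq u * k)%:~R = (numq u * k)%:~R.
  by rewrite !rmorphM /= mulrA numqE.
have Dx : x * D%:~R = (numq x * (denq y * denq z))%:~R.
  by rewrite -int_of; congr (_ * _%:~R); rewrite /D; ring.
have Dy : y * D%:~R = (numq y * (denq x * denq z))%:~R.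
  by rewrite -int_of; congr (_ * _%:~R); rewrite /D; ring.
have Dz : z * D%:~R = (numq z * (denq x * denq y))%:~R.
  by rewrite -int_of; congr (_ * _%:~R); rewrite /D; ring.
apply: (hilb_solution p_pr p_odd a0 b0 (x := numq x * (denq y * denq z))
  (y := numq y * (denq x * denq z)) (z := numq z * (denq x * denq y))).
  by rewrite !mulf_eq0 !numq_eq0 !(negbTE (denq_neq0 _)) !orbF.
apply: (@intr_inj rat); transitivity ((z * D%:~R) ^+ 2); first by rewrite Dz -rmorphXn.
transitivity (a%:~R * (x * D%:~R) ^+ 2 + b%:~R * (y * D%:~R) ^+ 2).
  by rewrite exprMn E; ring.
by rewrite Dx Dy -!rmorphXn -!rmorphM -rmorphD.
Qed.

Lemma hilb_inf_solution (a b : int) (x y z : rat) : [|| x != 0, y != 0 | z != 0] ->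
  z ^+ 2 = a%:~R * x ^+ 2 + b%:~R * y ^+ 2 -> ~~ ((a < 0) && (b < 0)).
Proof.
move=> nz E; apply/negP => /andP[an bn].
have a' : a%:~R < 0 :> rat by rewrite ltrz0.
have b' : b%:~R < 0 :> rat by rewrite ltrz0.
have x2 := sqr_ge0 x; have y2 := sqr_ge0 y; have z2 := sqr_ge0 z.
have ax : a%:~R * x ^+ 2 <= 0 by rewrite nmulr_rle0.
have by' : b%:~R * y ^+ 2 <= 0 by rewrite nmulr_rle0.
have z0 : z ^+ 2 = 0 by lra.
have ax0 : a%:~R * x ^+ 2 = 0 by lra.
have by0 : b%:~R * y ^+ 2 = 0 by lra.
have /eqP x0 : x == 0 by move/eqP: ax0; rewrite mulf_eq0 (lt_eqF a') sqrf_eq0.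
have /eqP y0 : y == 0 by move/eqP: by0; rewrite mulf_eq0 (lt_eqF b') sqrf_eq0.
have /eqP z0' : z == 0 by rewrite -sqrf_eq0 z0.
by move: nz; rewrite x0 y0 z0' eqxx.
Qed.

(** The common value t0 = a x^2 + b y^2 becomes an integer on scaling by the square of its
    denominator, unless it is 0, where symbols make no sense. If t0 = 0 with y nonzero, the first
    half is isotropic and t = n will do; if x = y = 0, the second half is isotropic and t = a will
    do. *)
Lemma split_of_represented (a b c n : int) (N m : rat) : a != 0 -> b != 0 -> c != 0 ->
  n != 0 -> N != 0 -> N = n%:~R * m ^+ 2 -> represented a b c N ->
  exists (t : int) (x y z w : rat), [/\ t != 0,
    a%:~R * x ^+ 2 + b%:~R * y ^+ 2 = t%:~R &
    (- c)%:~R * z ^+ 2 + n%:~R * w ^+ 2 = t%:~R].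
Proof.
move=> a0 b0 c0 n0 N0 NE [x [y [z E]]].
have m0 : m != 0 by apply: contraNneq N0 => m0; rewrite NE m0 expr0n mulr0.
have a0' : a%:~R != 0 :> rat by rewrite intr_eq0.
have c0' : c%:~R != 0 :> rat by rewrite intr_eq0.
have n0' : n%:~R != 0 :> rat by rewrite intr_eq0.
have {}E : a%:~R * (x / m) ^+ 2 + b%:~R * (y / m) ^+ 2 + c%:~R * (z / m) ^+ 2 = n%:~R.
  rewrite !expr_div_n.
  transitivity ((a%:~R * x ^+ 2 + b%:~R * y ^+ 2 + c%:~R * z ^+ 2) / m ^+ 2); first by ring.
  by rewrite E NE mulfK // expf_neq0.
move: (x / m) (y / m) (z / m) E => {}x {}y {}z E.
pose t0 := a%:~R * x ^+ 2 + b%:~R * y ^+ 2.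
have t0E : (- c)%:~R * z ^+ 2 + n%:~R * 1 ^+ 2 = t0.
  by rewrite /t0 -E rmorphN /=; ring.
have [t00|t00] := eqVneq t0 0; last first.
  have [d [k [k0 kE]]] : exists (d : rat) (k : int), k != 0 /\ k%:~R = t0 * d ^+ 2.
    exists (denq t0)%:~R, (numq t0 * denq t0).
    by rewrite mulf_neq0 ?numq_eq0 ?denq_neq0 // rmorphM /= numqE -mulrA.
  exists k, (x * d), (y * d), (z * d), d; split=> //; rewrite kE.
    by rewrite /t0; ring.
  by rewrite -t0E; ring.
have [y0|y0] := eqVneq y 0.
  have x0 : x = 0.
    move/eqP: t00; rewrite /t0 y0 expr0n /= mulr0 addr0 mulf_eq0 (negbTE a0') sqrf_eq0.
    by move/eqP.
  have z0 : z != 0.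
    apply: contraNneq n0' => z0.
    by rewrite -E x0 y0 z0 expr0n /= !mulr0 !addr0.
  have : c%:~R != 0 :> rat by [].
  have E0 : n%:~R * z^-1 ^+ 2 + (- c)%:~R = 0.
    rewrite -E x0 y0 expr0n /= !mulr0 !add0r rmorphN /=; field; exact: z0.
  have z1 : z^-1 != 0 by rewrite invr_eq0.
  have [w [z' E']] := binary_isotropic_universal a%:~R n0' z1 E0.
  exists a, 1, 0, z', w; split=> //; last by rewrite addrC.
  by rewrite expr1n mulr1 expr0n mulr0 addr0.
have x0 : x != 0.
  apply/eqP => x0; move/eqP: t00; rewrite /t0 x0 expr0n /= mulr0 add0r mulf_eq0 intr_eq0.
  by rewrite (negbTE b0) sqrf_eq0 (negbTE y0).
have E0 : a%:~R * (x / y) ^+ 2 + b%:~R = 0.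
  rewrite expr_div_n; transitivity (t0 / y ^+ 2); last by rewrite t00 mul0r.
  by rewrite /t0; field.
have xy0 : x / y != 0 by rewrite mulf_neq0 // invr_eq0.
have [x' [y' E']] := binary_isotropic_universal n%:~R a0' xy0 E0.
exists n, x', y', 0, 1; split=> //.
by rewrite expr1n mulr1 expr0n mulr0 add0r.
Qed.

(* Solvability of a x^2 + b y^2 = t at an odd prime (with d the character of -1),
   at 2 and at the real place (with signs), in terms of the classes of a, b, t. *)
Definition obin d (A B t : bool * bool) : bool :=
  ~~ osym d (oadd A t) (oadd (false, d) (oadd A B)).
Definition dbin (A B t : bool * (bool * bool)) : bool :=
  ~~ dsym (dadd A t) (dadd (false, (true, false)) (dadd A B)).
Definition sbin (A B t : bool) : bool := ~~ ((A (+) t) && ~~ (A (+) B)).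

(* Both a x^2 + b y^2 = t and - c z^2 + n w^2 = t are solvable. *)
Definition osplit d A B C N t := obin d A B t && obin d (oadd (false, d) C) N t.
Definition dsplit A B C N t := dbin A B t && dbin (dadd (false, (true, false)) C) N t.
Definition ssplit A B C N t := sbin A B t && sbin (~~ C) N t.

Lemma hilb_obin p a b t : prime p -> odd p -> a != 0 -> b != 0 -> t != 0 ->
  hilb p (a * t) (- (a * b)) = ~~ obin (qnr p (-1)) (ocls p a) (ocls p b) (ocls p t).
Proof.
move=> p_pr p_odd a0 b0 t0.
by rewrite /hilb /obin negbK -[- (a * b)]mulN1r !oclsM ?mulf_neq0 // oclsN1.
Qed.

Lemma hilb2_dbin a b t : a != 0 -> b != 0 -> t != 0 ->
  hilb2 (a * t) (- (a * b)) = ~~ dbin (dcls a) (dcls b) (dcls t).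
Proof.
move=> a0 b0 t0.
by rewrite /hilb2 /dbin negbK -[- (a * b)]mulN1r !dclsM ?mulf_neq0 // dclsN1.
Qed.

Lemma hilb_inf_sbin (a b t : int) : a != 0 -> b != 0 -> t != 0 ->
  (a * t < 0) && (- (a * b) < 0) = ~~ sbin (a < 0) (b < 0) (t < 0).
Proof.
move=> a0 b0 t0; have ab0 : a * b != 0 by rewrite mulf_neq0.
rewrite /sbin negbK oppr_lt0 [0 < _]ltNge le_eqVlt (negbTE ab0) /=.
by rewrite !mulr_lt0 a0 b0 t0.
Qed.

Lemma oclsN p c : prime p -> odd p -> c != 0 ->
  ocls p (- c) = oadd (false, qnr p (-1)) (ocls p c).
Proof. by move=> p_pr p_odd c0; rewrite -[- c]mulN1r oclsM // oclsN1. Qed.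

Lemma dclsN c : c != 0 -> dcls (- c) = dadd (false, (true, false)) (dcls c).
Proof. by move=> c0; rewrite -[- c]mulN1r dclsM // dclsN1. Qed.

Lemma obin_far d A B t : ~~ A.1 -> ~~ B.1 -> ~~ t.1 -> obin d A B t.
Proof. by case: A B t => [[] []] [[] []] [[] []]; case: d. Qed.

Lemma binary_local (a b : int) (t : int) (x y : rat) : a != 0 -> b != 0 -> t != 0 ->
  a%:~R * x ^+ 2 + b%:~R * y ^+ 2 = t%:~R ->
  [/\ forall p, prime p -> odd p -> obin (qnr p (-1)) (ocls p a) (ocls p b) (ocls p t),
    dbin (dcls a) (dcls b) (dcls t) & sbin (a < 0) (b < 0) (t < 0)].
Proof.
move=> a0 b0 t0 E.
have E' : (a%:~R * x) ^+ 2 = (a * t)%:~R * 1 ^+ 2 + (- (a * b))%:~R * y ^+ 2.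
  by rewrite rmorphN !rmorphM /= -E; ring.
have nz : [|| (1 : rat) != 0, y != 0 | a%:~R * x != 0] by [].
have at0 : a * t != 0 by rewrite mulf_neq0.
have ab0 : - (a * b) != 0 by rewrite oppr_eq0 mulf_neq0.
have Hp p : prime p -> odd p -> hilb p (a * t) (- (a * b)) = false.
  by move=> p_pr p_odd; apply: (hilb_solution_rat p_pr p_odd at0 ab0 nz E').
have Hinf := hilb_inf_solution nz E'.
split=> [p p_pr p_odd||].
- by have := Hp p p_pr p_odd; rewrite hilb_obin // => /negbFE.
- by have := hilb2_last at0 ab0 Hp Hinf; rewrite hilb2_dbin // => /negbFE.
by move: Hinf; rewrite hilb_inf_sbin // negbK.
Qed.

Section LocalGlobal.
Variables (a b c n : int) (N m : rat).
Hypotheses (a0 : a != 0) (b0 : b != 0) (c0 : c != 0) (n0 : n != 0) (N0 : N != 0).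
Hypothesis NE : N = n%:~R * m ^+ 2.

Lemma represented_local : represented a b c N <->
  [/\ forall p, prime p -> odd p ->
      exists t, osplit (qnr p (-1)) (ocls p a) (ocls p b) (ocls p c) (ocls p n) t,
    exists t, dsplit (dcls a) (dcls b) (dcls c) (dcls n) t &
    exists t, ssplit (a < 0) (b < 0) (c < 0) (n < 0) t].
Proof.
have c0' : - c != 0 by rewrite oppr_eq0.
have sN : (- c < 0) = ~~ (c < 0) by rewrite oppr_lt0 ltNge le_eqVlt (negbTE c0).
split=> [|[Hp [t2 H2] [ts Hs]]].
  case/(split_of_represented a0 b0 c0 n0 N0 NE) => t [x [y [z [w [t0 E1 E2]]]]].
  have [P1 D1 S1] := binary_local a0 b0 t0 E1.
  have [P2 D2 S2] := binary_local c0' n0 t0 E2.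
  split=> [p p_pr p_odd||].
  - by exists (ocls p t); rewrite /osplit P1 // -oclsN // P2.
  - by exists (dcls t); rewrite /dsplit D1 -dclsN // D2.
  - by exists (t < 0); rewrite /ssplit S1 -sN S2.
pose B := (`|a| + `|b| + `|c| + `|n|)%N.
(* At an odd prime the choice always succeeds by [Hp]; the default only makes [tp] total. *)
pose tp p := odflt (false, false)
  [pick t | osplit (qnr p (-1)) (ocls p a) (ocls p b) (ocls p c) (ocls p n) t].
have tpP p : prime p -> odd p ->
    osplit (qnr p (-1)) (ocls p a) (ocls p b) (ocls p c) (ocls p n) (tp p).
  move=> p_pr p_odd; rewrite /tp; case: pickP => //= none.
  by have [t] := Hp p p_pr p_odd; rewrite none.
have [t [q [t0 ts_E t2_E [q_pr q_odd Bq] [tp_E far_E]]]] := exists_with_classes B ts t2 tp.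
have far p (k : int) : prime p -> k != 0 -> (`|k| <= B)%N -> (B < p)%N -> ~~ (ocls p k).1.
  move=> p_pr k0 kB Bp; have pk : ~~ (p %| k)%Z.
    rewrite dvdzE /=; apply/negP => /dvdn_leq; rewrite absz_gt0 k0 => /(_ isT).
    by rewrite leqNgt (leq_ltn_trans kB).
  by rewrite /ocls; have [-> _] := upart_unit p_pr pk.
have aB : (`|a| <= B)%N by rewrite /B; lia.
have bB : (`|b| <= B)%N by rewrite /B; lia.
have cB : (`|c| <= B)%N by rewrite /B; lia.
have cNB : (`|- c| <= B)%N by rewrite abszN.
have nB : (`|n| <= B)%N by rewrite /B; lia.
have binary (k l : int) : k != 0 -> l != 0 -> (`|k| <= B)%N -> (`|l| <= B)%N ->
    (forall p, prime p -> odd p -> (p <= B)%N -> obin (qnr p (-1)) (ocls p k) (ocls p l) (ocls p t)) ->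
    dbin (dcls k) (dcls l) (dcls t) -> sbin (k < 0) (l < 0) (t < 0) ->
    exists x y : rat, k%:~R * x ^+ 2 + l%:~R * y ^+ 2 = t%:~R.
  move=> k0 l0 kB lB Op O2 Os.
  have kt0 : k * t != 0 by rewrite mulf_neq0.
  have kl0 : - (k * l) != 0 by rewrite oppr_eq0 mulf_neq0.
  have Hinf : ~~ ((k * t < 0) && (- (k * l) < 0)) by rewrite hilb_inf_sbin // negbK.
  have Hpq p : prime p -> odd p -> p != q -> hilb p (k * t) (- (k * l)) = false.
    move=> p_pr p_odd pq; rewrite hilb_obin //; apply/negbF.
    have [pB|Bp] := leqP p B; first exact: Op.
    by apply: obin_far; [apply: far | apply: far | apply: far_E].
  apply: binary_represents => // p p_pr p_odd.
  have [->|] := eqVneq p q; last exact: Hpq.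
  by apply: hilb_last => //; rewrite hilb2_dbin // O2.
apply: (represented_of_split a0 b0 c0 t0 NE); apply: binary => //.
- by move=> p p_pr p_odd pB; rewrite tp_E //; case/andP: (tpP p p_pr p_odd).
- by rewrite t2_E; case/andP: H2.
- by rewrite ts_E; case/andP: Hs.
- by move=> p p_pr p_odd pB; rewrite oclsN // tp_E //; case/andP: (tpP p p_pr p_odd).
- by rewrite dclsN // t2_E; case/andP: H2.
- by rewrite sN ts_E; case/andP: Hs.
Qed.

End LocalGlobal.

(** * The local conditions *)

Lemma ssplit_iff A B C N : (exists t, ssplit A B C N t) <->
  ~~ [&& ~~ A, ~~ B, ~~ C & N] && ~~ [&& A, B, C & ~~ N].
Proof.
split=> [[]|]; first by case: A B C N => [] [] [] [] [].
by case: A B C N => [] [] [] [] //= _; first [by exists true | by exists false].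
Qed.

(** One line of condition (4) in classes: when p divides a and n, [d (+) (B.2 (+) C.2)] is the
    character of -bc and [N.2 (+) A.2] that of na/p^2. *)
Definition ocond (d : bool) (B C A N : bool * bool) : bool :=
  N.1 && A.1 ==> ~~ (d (+) (B.2 (+) C.2)) || ~~ (N.2 (+) A.2).

Lemma osplit_iff d A B C N : ~~ (A.1 && B.1) -> ~~ (A.1 && C.1) -> ~~ (B.1 && C.1) ->
  (exists t, osplit d A B C N t) <->
  [&& ocond d B C A N, ocond d A C B N & ocond d A B C N].
Proof.
move=> AB AC BC; split=> [[t]|].
  move: AB AC BC; case: t => [[] []]; case: d;
  case: A B C N => [[] []] [[] []] [[] []] [[] []] //.
have has_ex : has (osplit d A B C N)
    [:: (false, false); (false, true); (true, false); (true, true)] ->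
    exists t, osplit d A B C N t by case/hasP=> t _ Ht; exists t.
move=> H; apply: has_ex; move: AB AC BC H; case: d;
case: A B C N => [[] []] [[] []] [[] []] [[] []] //.
Qed.

(** For an integer not divisible by 4, the residue modulo 16 determines the class at 2: halving an
    even one leaves its unit part modulo 8. *)
Definition dcls16 (r : nat) : bool * (bool * bool) :=
  let u := if odd r then r else r./2 in
  (~~ odd r, ((u %% 4 == 3)%N, (u %% 8 == 3)%N || (u %% 8 == 5)%N)).

(** Reduced after each product, so that the unary numbers stay small in the exhaustive check. *)
Definition prod16 (a b c : nat) : nat := ((a * b) %% 16 * c) %% 16.

Definition dcond_odd (a b c n : nat) : bool :=
  [&& odd a, odd b, odd c, a %% 4 == b %% 4 & b %% 4 == c %% 4]%N ==>
  ((n + prod16 a b c) %% 8 != 0)%N.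

Definition dcond_even (a b c n : nat) : bool :=
  ~~ odd a && (((b + c) %% 8 == a %% 8)%N || ((b + c) %% 8 == (2 * a) %% 8)%N) ==>
  ((n + prod16 a b c) %% 16 != 0)%N.

Definition dcond (a b c n : nat) : bool :=
  [&& dcond_odd a b c n, dcond_even a b c n, dcond_even b a c n & dcond_even c a b n].

Definition residues16 := [:: 1; 2; 3; 5; 6; 7; 9; 10; 11; 13; 14; 15]%N.

Definition all_dcls : seq (bool * (bool * bool)) :=
  [:: (false, (false, false)); (false, (false, true)); (false, (true, false));
      (false, (true, true)); (true, (false, false)); (true, (false, true));
      (true, (true, false)); (true, (true, true))].

(** Conditions (2) and (3) are exactly the solvability at 2, by exhaustion over the residues of
    square-free integers and the eight square classes of t. The first three disjuncts set aside two
    even coefficients, which coprimality excludes. *)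
Lemma dcond_check :
  all (fun a => all (fun b => all (fun c => all (fun n =>
    [|| ~~ odd a && ~~ odd b, ~~ odd a && ~~ odd c, ~~ odd b && ~~ odd c |
      has (dsplit (dcls16 a) (dcls16 b) (dcls16 c) (dcls16 n)) all_dcls
        == dcond a b c n])
    residues16) residues16) residues16) residues16.
Proof. by vm_compute. Qed.

Definition res16 (a : int) : nat := `|(a %% 16)%Z|%N.

Lemma squarefree_mod4 a : squarefree a -> ~~ (4 %| a)%Z.
Proof. by move=> sqf; apply/negP => /(sqf 2). Qed.

Lemma squarefree_res16 a : squarefree a -> res16 a \in residues16.
Proof.
move=> /squarefree_mod4 a4; have : (res16 a < 16)%N by rewrite /res16; lia.
have : ~~ (4 %| res16 a)%N by rewrite /res16; move: a4; lia.
by move: (res16 a); do 16![case=> //].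
Qed.

Lemma dcls_res16 a : squarefree a -> dcls a = dcls16 (res16 a).
Proof.
move=> /squarefree_mod4 a4; have [a_even|a_odd] := boolP (2 %| a)%Z.
  have /dvdzP[u uE] := a_even; have u_odd : ~~ (2 %| u)%Z by move: a4; rewrite uE; lia.
  have aE : a = (2 ^ 1)%N%:Z * u by rewrite uE mulrC.
  have r_even : odd (res16 a) = false by rewrite /res16 uE; lia.
  rewrite /dcls /dcls16; have [-> ->] := upart_unique (isT : prime 2) u_odd aE.
  rewrite r_even /=; congr (_, (_, _ || _)); rewrite /res16 uE; lia.
have r_odd : odd (res16 a) by rewrite /res16; move: a_odd; lia.
rewrite /dcls /dcls16; have [-> ->] := upart_unit (isT : prime 2) a_odd.
rewrite r_odd /=; congr (_, (_, _ || _)); rewrite /res16; lia.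
Qed.

Lemma prod16P (a b c : int) :
  (a * b * c %% 16)%Z = (prod16 (res16 a) (res16 b) (res16 c))%:Z.
Proof.
have rE k : (res16 k)%:Z = (k %% 16)%Z by rewrite /res16 gez0_abs // modz_ge0.
rewrite /prod16 -!modz_nat !PoszM -modz_nat PoszM !rE.
by rewrite -[LHS]modzMm -[(a * b %% 16)%Z]modzMm.
Qed.

Section DyadicConditions.
Variables (a b c n : int).
Hypotheses (a_sqf : squarefree a) (b_sqf : squarefree b).
Hypotheses (c_sqf : squarefree c) (n_sqf : squarefree n).

Lemma dcond_oddP : dcond_odd (res16 a) (res16 b) (res16 c) (res16 n) <->
  (~~ (2 %| a)%Z -> ~~ (2 %| b)%Z -> ~~ (2 %| c)%Z ->
      (a = b %[mod 4])%Z -> (b = c %[mod 4])%Z ->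
      (n <> - (a * b * c) %[mod 8])%Z).
Proof.
have := prod16P a b c; rewrite /dcond_odd /res16.
move: (prod16 _ _ _) (a * b * c) => P X XP.
have -> : odd `|(a %% 16)%Z| = ~~ (2 %| a)%Z by lia.
have -> : odd `|(b %% 16)%Z| = ~~ (2 %| b)%Z by lia.
have -> : odd `|(c %% 16)%Z| = ~~ (2 %| c)%Z by lia.
have -> : (`|(a %% 16)%Z| %% 4 == `|(b %% 16)%Z| %% 4)%N = ((a %% 4)%Z == (b %% 4)%Z) by lia.
have -> : (`|(b %% 16)%Z| %% 4 == `|(c %% 16)%Z| %% 4)%N = ((b %% 4)%Z == (c %% 4)%Z) by lia.
have -> : ((`|(n %% 16)%Z| + P) %% 8 != 0)%N = ((n %% 8)%Z != (- X %% 8)%Z) by lia.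
split=> [/implyP H a2 b2 c2 ab bc|H].
  by apply/eqP/H; rewrite a2 b2 c2 ab bc !eqxx.
by apply/implyP => /and5P[a2 b2 c2 /eqP ab /eqP bc]; apply/eqP; apply: H.
Qed.

Lemma dcond_evenP : dcond_even (res16 a) (res16 b) (res16 c) (res16 n) <->
  ((2 %| a)%Z -> (b + c = a %[mod 8])%Z \/ (b + c = 2 * a %[mod 8])%Z ->
       (n <> - (a * b * c) %[mod 16])%Z).
Proof.
have := prod16P a b c; rewrite /dcond_even /res16.
move: (prod16 _ _ _) (a * b * c) => P X XP.
have -> : ~~ odd `|(a %% 16)%Z| = (2 %| a)%Z by lia.
have -> : ((`|(b %% 16)%Z| + `|(c %% 16)%Z|) %% 8 == `|(a %% 16)%Z| %% 8)%N =
  (((b + c) %% 8)%Z == (a %% 8)%Z) by lia.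
have -> : ((`|(b %% 16)%Z| + `|(c %% 16)%Z|) %% 8 == (2 * `|(a %% 16)%Z|) %% 8)%N =
  (((b + c) %% 8)%Z == ((2 * a) %% 8)%Z) by lia.
have -> : ((`|(n %% 16)%Z| + P) %% 16 != 0)%N = ((n %% 16)%Z != (- X %% 16)%Z) by lia.
split=> [/implyP H a2 bc|H].
  by apply/eqP/H; rewrite a2; case: bc => ->; rewrite eqxx ?orbT.
apply/implyP => /andP[a2 bc]; apply/eqP; apply: H => //.
by case/orP: bc => /eqP; [left | right].
Qed.

Lemma dsplit_iff : coprimez a b -> coprimez a c -> coprimez b c ->
  (exists t, dsplit (dcls a) (dcls b) (dcls c) (dcls n) t) <->
  dcond (res16 a) (res16 b) (res16 c) (res16 n).
Proof.
move=> cab cac cbc.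
have parity x y : coprimez x y -> ~~ (~~ odd (res16 x) && ~~ odd (res16 y)).
  move=> cxy; have E z : odd (res16 z) = ~~ (2 %| z)%Z by rewrite /res16; lia.
  rewrite !E !negbK; apply/negP => xy2; have := dvdz_gcd 2 x y.
  by rewrite xy2 (eqP cxy).
have := allP (allP (allP (allP dcond_check _ (squarefree_res16 a_sqf)) _
  (squarefree_res16 b_sqf)) _ (squarefree_res16 c_sqf)) _ (squarefree_res16 n_sqf).
rewrite (negbTE (parity _ _ cab)) (negbTE (parity _ _ cac)) (negbTE (parity _ _ cbc)) !orFb.
rewrite -!dcls_res16 // => /eqP <-; split=> [[t Ht]|/hasP[t _ Ht]]; last by exists t.
by apply/hasP; exists t => //; case: t {Ht} => [[] [[] []]].
Qed.
End DyadicConditions.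

Lemma squarefree_neq0 a : squarefree a -> a != 0.
Proof. by move=> sqf; apply/eqP => a0; have := sqf 0; rewrite a0 => /(_ isT). Qed.

Lemma squarefree_logn p a : prime p -> squarefree a -> logn p `|a| = (p %| a)%Z.
Proof.
move=> p_pr a_sqf; have a0 := squarefree_neq0 a_sqf.
have a_gt0 : (0 < `|a|)%N by rewrite absz_gt0.
have l1 : (logn p `|a| <= 1)%N.
  rewrite leqNgt -pfactor_dvdn //; apply/negP => p2a.
  have := a_sqf p; rewrite dvdzE abszX => /(_ p2a) [p1].
  by move: p_pr; rewrite p1.
have : (0 < logn p `|a|)%N = (p %| a)%Z.
  by rewrite logn_gt0 mem_primes p_pr a_gt0 dvdzE.
by move: l1; case: (logn p _) => [|[|]] //= _ <-.
Qed.

Lemma ocls_squarefree p a : prime p -> squarefree a -> (ocls p a).1 = (p %| a)%Z.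
Proof. by move=> p_pr a_sqf; rewrite /ocls squarefree_logn //= oddb. Qed.

Lemma ocls_unit p a : prime p -> ~~ (p %| a)%Z -> (ocls p a).2 = qnr p a.
Proof. by move=> p_pr pa; rewrite /ocls; have [_ ->] := upart_unit p_pr pa. Qed.

Lemma ocond_legendre (p : nat) (a b c n : int) : prime p -> odd p ->
  squarefree a -> squarefree n -> coprimez a b -> coprimez a c ->
  ocond (qnr p (-1)) (ocls p b) (ocls p c) (ocls p a) (ocls p n) <->
  ((p %| n)%Z -> (p %| a)%Z -> legendre (- (b * c)) p = 1 \/
     legendre ((n * a) %/ (p ^ 2)%N)%Z p = 1).
Proof.
move=> p_pr p_odd a_sqf n_sqf cab cac; rewrite /ocond !ocls_squarefree //.
have [pn|] := boolP (p %| n)%Z; last by split.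
have [pa|] := boolP (p %| a)%Z; last by split.
have cop x : coprimez a x -> ~~ (p %| x)%Z.
  move=> cax; apply/negP => px; have := dvdz_gcd p a x.
  by rewrite pa px (eqP cax) dvdz1 /= => /eqP p1; move: p_pr; rewrite p1.
have [pb pc] := (cop b cab, cop c cac).
have pN1 := prime_ndvdzN1 p_pr.
have pbc : ~~ (p %| b * c)%Z by apply: ndvdzM.
have pNbc : ~~ (p %| - (b * c))%Z by rewrite rpredN.
have a0 := squarefree_neq0 a_sqf; have n0 := squarefree_neq0 n_sqf.
have [pua _] := upartP p_pr a0; have [pun _] := upartP p_pr n0.
have [ln un] := upartM p_pr n0 a0.
(* p divides n and a exactly once each, both being square-free. *)
have -> : (n * a %/ (p ^ 2)%N)%Z = upart p n * upart p a.
  by rewrite -un /upart ln !squarefree_logn // pn pa.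
have Ebc : qnr p (-1) (+) ((ocls p b).2 (+) (ocls p c).2) = qnr p (- (b * c)).
  by rewrite !ocls_unit // -[- (b * c)]mulN1r !qnrM.
have Ena : (ocls p n).2 (+) (ocls p a).2 = qnr p (upart p n * upart p a) by rewrite qnrM.
rewrite Ebc Ena /=; have pna : ~~ (p %| upart p n * upart p a)%Z by apply: ndvdzM.
have L1 := legendre_qnr p_pr p_odd pNbc; have L2 := legendre_qnr p_pr p_odd pna.
split=> [/orP[H|H] _ _|/(_ isT isT)[H|H]].
- by left; apply/L1.
- by right; apply/L2.
- by apply/orP; left; apply/L1.
- by apply/orP; right; apply/L2.
Qed.

Theorem theorem8 (a b c : int) (N : rat) (n : int) (m : rat)
  (a_neq0 : a != 0) (b_neq0 : b != 0) (c_neq0 : c != 0)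
  (a_sqf : squarefree a) (b_sqf : squarefree b) (c_sqf : squarefree c)
  (coprime_ab : coprimez a b) (coprime_ac : coprimez a c)
  (coprime_bc : coprimez b c)
  (N_neq0 : N != 0) (n_sqf : squarefree n) (N_def : N = n%:~R * m ^+ 2) :
  represented a b c N <->
  ((* (1) *)
   ((0 < a -> 0 < b -> 0 < c -> 0 < N) /\
    (a < 0 -> b < 0 -> c < 0 -> N < 0)) /\
   (* (2) *)
   (~~ (2 %| a)%Z -> ~~ (2 %| b)%Z -> ~~ (2 %| c)%Z ->
      (a = b %[mod 4])%Z -> (b = c %[mod 4])%Z ->
      (n <> - (a * b * c) %[mod 8])%Z) /\
   (* (3), according to which coefficient is even *)
   (((2 %| a)%Z ->
       (b + c = a %[mod 8])%Z \/ (b + c = 2 * a %[mod 8])%Z ->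
       (n <> - (a * b * c) %[mod 16])%Z) /\
    ((2 %| b)%Z ->
       (a + c = b %[mod 8])%Z \/ (a + c = 2 * b %[mod 8])%Z ->
       (n <> - (a * b * c) %[mod 16])%Z) /\
    ((2 %| c)%Z ->
       (a + b = c %[mod 8])%Z \/ (a + b = 2 * c %[mod 8])%Z ->
       (n <> - (a * b * c) %[mod 16])%Z)) /\
   (* (4) *)
   ((forall p : nat, prime p -> odd p -> (p %| n)%Z -> (p %| a)%Z ->
       legendre (- (b * c)) p = 1 \/
       legendre ((n * a) %/ (p ^ 2)%N)%Z p = 1) /\
    (forall p : nat, prime p -> odd p -> (p %| n)%Z -> (p %| b)%Z ->
       legendre (- (a * c)) p = 1 \/
       legendre ((n * b) %/ (p ^ 2)%N)%Z p = 1) /\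
    (forall p : nat, prime p -> odd p -> (p %| n)%Z -> (p %| c)%Z ->
       legendre (- (a * b)) p = 1 \/
       legendre ((n * c) %/ (p ^ 2)%N)%Z p = 1))).
Proof.
have n_neq0 := squarefree_neq0 n_sqf.
have m_neq0 : m != 0 by apply: contraNneq N_neq0 => m0; rewrite N_def m0 expr0n mulr0.
have m2 : 0 < m ^+ 2 by rewrite lt_def sqrf_eq0 m_neq0 sqr_ge0.
have N_gt0 : (0 < N) = (0 < n) by rewrite N_def pmulr_lgt0 // ltr0z.
have N_lt0 : (N < 0) = (n < 0) by rewrite N_def pmulr_llt0 // ltrz0.
have gt0E (k : int) : k != 0 -> (0 < k) = ~~ (k < 0).
  by move=> k0; rewrite ltNge le_eqVlt (negbTE k0).
have coprime_ndvd2 (p : nat) (x y : int) : prime p -> coprimez x y ->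
    ~~ ((p %| x)%Z && (p %| y)%Z).
  move=> p_pr cxy; apply/negP => pxy; have := dvdz_gcd p x y.
  by rewrite pxy (eqP cxy) dvdz1 /= => /eqP p1; move: p_pr; rewrite p1.
have sign_iff : (exists t, ssplit (a < 0) (b < 0) (c < 0) (n < 0) t) <->
    ((0 < a -> 0 < b -> 0 < c -> 0 < N) /\ (a < 0 -> b < 0 -> c < 0 -> N < 0)).
  apply: (iff_trans (ssplit_iff _ _ _ _)); rewrite N_gt0 N_lt0 !gt0E //.
  by case: (a < 0) (b < 0) (c < 0) (n < 0) => [] [] [] [];
    split=> //= -[H1 H2]; try exact: H1; try exact: H2.
have even_iff := dsplit_iff a_sqf b_sqf c_sqf n_sqf coprime_ab coprime_ac coprime_bc.
have coprime_ba : coprimez b a by rewrite coprimez_sym.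
have coprime_ca : coprimez c a by rewrite coprimez_sym.
have coprime_cb : coprimez c b by rewrite coprimez_sym.
have odd_iff p : prime p -> odd p ->
    (exists t, osplit (qnr p (-1)) (ocls p a) (ocls p b) (ocls p c) (ocls p n) t) <->
    [/\ ((p %| n)%Z -> (p %| a)%Z -> legendre (- (b * c)) p = 1 \/
          legendre ((n * a) %/ (p ^ 2)%N)%Z p = 1),
        ((p %| n)%Z -> (p %| b)%Z -> legendre (- (a * c)) p = 1 \/
          legendre ((n * b) %/ (p ^ 2)%N)%Z p = 1) &
        ((p %| n)%Z -> (p %| c)%Z -> legendre (- (a * b)) p = 1 \/
          legendre ((n * c) %/ (p ^ 2)%N)%Z p = 1)].
  move=> p_pr p_odd; apply: (iff_trans (osplit_iff _ _ _ _ _)).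
  - by rewrite !ocls_squarefree // coprime_ndvd2.
  - by rewrite !ocls_squarefree // coprime_ndvd2.
  - by rewrite !ocls_squarefree // coprime_ndvd2.
  have A := ocond_legendre p_pr p_odd a_sqf n_sqf coprime_ab coprime_ac.
  have B := ocond_legendre p_pr p_odd b_sqf n_sqf coprime_ba coprime_bc.
  have C := ocond_legendre p_pr p_odd c_sqf n_sqf coprime_ca coprime_cb.
  split=> [/and3P[/A ? /B ? /C ?]|[/A ? /B ? /C ?]]; first by split.
  by apply/and3P; split.
have O := dcond_oddP a b c n; have E1 := dcond_evenP a b c n.
have E2 := dcond_evenP b a c n; have E3 := dcond_evenP c a b n.
rewrite (_ : b * a * c = a * b * c) in E2; last by rewrite [b * a]mulrC.
rewrite (_ : c * a * b = a * b * c) in E3; last by rewrite -mulrA mulrC.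
apply: (iff_trans (represented_local a_neq0 b_neq0 c_neq0 n_neq0 N_neq0 N_def)).
split=> [[Hodd /even_iff/and4P[/O H2 /E1 Ha /E2 Hb /E3 Hc] /sign_iff H1]|].
  split; first exact: H1.
  split; first exact: H2.
  split; first by split.
  split; last split; move=> p p_pr p_odd.
  - by have /(odd_iff p p_pr p_odd)[] := Hodd p p_pr p_odd.
  - by have /(odd_iff p p_pr p_odd)[] := Hodd p p_pr p_odd.
  - by have /(odd_iff p p_pr p_odd)[] := Hodd p p_pr p_odd.
move=> [H1 [/O H2 [[/E1 Ha [/E2 Hb /E3 Hc]] [Pa [Pb Pc]]]]]; split.
- move=> p p_pr p_odd; apply/(odd_iff p p_pr p_odd).
  by split; [apply: Pa | apply: Pb | apply: Pc].
- by apply/even_iff/and4P.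
by apply/sign_iff.
Qed.
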